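(* Let $\mu$ be a probability measure on $\mathbb{R}^n$ (for which the covariance matrix $\mathrm{Cov}(\mu)$ is defined) such that its entropy $H_\nu(\mu)$ exists with respect to some background measure $\nu$ on $\mathbb{R}^n$. Then for every positive definite matrix $L \in \mathcal{M}_{n\times n}$ there exist a probability measure $m$ on some index set $\mathcal{I}$ and a family of probability measures $\{\mu_\theta\}_{\theta\in\mathcal{I}}$ on $\mathbb{R}^n$ such that $$\mu(A)=\int_{\mathcal{I}}\mu_\theta(A)\,dm(\theta)\qquad\text{for all measurable } A\subset\mathbb{R}^n,$$ and such that the following three properties hold: 1. $$H_\nu(\mu)-\mathbb{E}_{\theta\sim m}H_\nu(\mu_\theta)\le \log\det\left(\mathrm{Cov}(\mu)L+\mathrm{Id}\right)\le \mathrm{Tr}\left(\mathrm{Cov}(\mu)L\right);$$ 2. $$\mathbb{E}_{\theta\sim m}\mathrm{Cov}(\mu_\theta)\preceq L^{-1};$$ 3. $$\mathbb{E}_{\theta\sim m}\left[\mathrm{Cov}(\mu_\theta)\,L\,\mathrm{Cov}(\mu_\theta)\right]\preceq \mathrm{Cov}(\mu).$$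
   Context: For a measure $\mu$ absolutely continuous with respect to a background measure $\nu$ on $\mathbb{R}^n$, the entropy is $H_\nu(\mu)=-\int_{\mathbb{R}^n}\log\left(\frac{d\mu}{d\nu}\right)d\mu$, whenever the integral converges. The covariance matrix of $\mu$ is $\mathrm{Cov}(\mu)=\int x^{\otimes 2}\,d\mu(x)-\left(\int x\,d\mu(x)\right)^{\otimes 2}$, where $x^{\otimes 2}=xx^T$. Positive definite matrices are symmetric, $\mathrm{Id}$ is the $n\times n$ identity matrix, $\mathcal{M}_{n\times n}$ denotes real $n\times n$ matrices, $\log$ is the natural logarithm, and $A\preceq B$ means that $B-A$ is positive semidefinite. $\mathbb{E}_{\theta\sim m}$ denotes integration over $\theta$ with respect to $m$. *)

(* Defs.v *)
From HB Require Import structures.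
From mathcomp Require Import all_boot all_order all_algebra.
From mathcomp Require Import all_classical all_reals all_analysis.

Set Implicit Arguments.
Unset Strict Implicit.
Unset Printing Implicit Defensive.

Import Order.TTheory GRing.Theory Num.Theory.
Import numFieldNormedType.Exports.

Local Open Scope classical_set_scope.
Local Open Scope ring_scope.

Section symmetric_matrices.
Context {R : realType} {n : nat}.
Implicit Types A B : 'M[R]_n.

Definition posdefmx A : Prop :=
  A^T = A /\ forall v : 'cV[R]_n, v != 0 -> 0 < (v^T *m A *m v) 0 0.

Definition possemidefmx A : Prop :=
  A^T = A /\ forall v : 'cV[R]_n, 0 <= (v^T *m A *m v) 0 0.

Definition loewner_le A B : Prop := possemidefmx (B - A).

End symmetric_matrices.

Section entropy.
Context {d} {T : measurableType d} {R : realType}.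
Implicit Types nu mu : {measure set T -> \bar R}.

Definition is_density nu mu (f : T -> R) : Prop :=
  [/\ measurable_fun setT f,
      (forall x, 0 <= f x) &
      forall A, measurable A -> mu A = (\int[nu]_(x in A) (f x)%:E)%E].

(* The derivative d mu / d nu.  The library's ['d mu '/d nu] is available for a
   sigma-finite nu only, whereas here nu is arbitrary.  When mu is finite, two
   densities agree nu-almost everywhere (for any nu), so what follows does not
   depend on the choice made by xget. *)
Definition density nu mu : T -> R := xget (cst 0) (is_density nu mu).

(* The value ln 0 = 0 is harmless, as the density is positive mu-a.e. *)
Definition entropy nu mu : R := - \int[mu]_x ln (density nu mu x).

(* Existence of a density is stronger than mu `<< nu in general, and equivalent
   to it when nu is sigma-finite (for mu finite). *)
Definition entropy_exists nu mu : Prop :=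
  (exists f, is_density nu mu f) /\
  mu.-integrable setT (fun x => (ln (density nu mu x))%:E).

End entropy.

Section matrix_integral.
Context {d} {T : measurableType d} {R : realType} {p q : nat}.

Definition mxintegrable (mu : {measure set T -> \bar R})
    (F : T -> 'M[R]_(p, q)) : Prop :=
  forall i j, mu.-integrable setT (fun x => (F x i j)%:E).

Definition mxintegral (mu : {measure set T -> \bar R})
    (F : T -> 'M[R]_(p, q)) : 'M[R]_(p, q) :=
  \matrix_(i, j) \int[mu]_x F x i j.

End matrix_integral.

(* R^n is n.-tuple R, whose measurable sets are generated by the coordinate
   maps: this is the Borel sigma-algebra of R^n. *)
Section covariance_matrix.
Context {R : realType} {n : nat}.
Implicit Type mu : {measure set (n.-tuple R) -> \bar R}.

Definition colvec (x : n.-tuple R) : 'cV[R]_n := \col_i tnth x i.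

Definition outer_square (v : 'cV[R]_n) : 'M[R]_n := v *m v^T.

Definition cov_exists mu : Prop :=
  mxintegrable mu colvec /\ mxintegrable mu (fun x => outer_square (colvec x)).

Definition covmx mu : 'M[R]_n :=
  mxintegral mu (fun x => outer_square (colvec x))
  - outer_square (mxintegral mu colvec).

End covariance_matrix.

(* Main.v *)
Require Import Defs.
From HB Require Import structures.
From mathcomp Require Import all_boot all_order all_algebra.
From mathcomp Require Import all_classical all_reals all_analysis.
From mathcomp Require Import measurable_realfun ring lra.

Set Implicit Arguments.
Unset Strict Implicit.
Unset Printing Implicit Defensive.

Import Order.TTheory GRing.Theory Num.Theory.
Import numFieldNormedType.Exports.

Local Open Scope classical_set_scope.
Local Open Scope ring_scope.

(* Factor L as M^T M and put Y(x) = M (x - E mu). Let x have law mu and let t be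
   uniform on [1, 2]; observe g = z + sqrt t Y(x), where z is an independent standard
   Gaussian vector. Let m be the law of theta = (t, g) and mu_theta the posterior law
   of x, whose density with respect to mu is an explicit Gaussian likelihood ratio.

   1. H(mu) - E H(mu_theta) is the mutual information of x and theta, which is at most
      the relative entropy of the channel to any law of g that does not depend on x.
      With S' = M Cov(mu) M^T, the law N(0, (1 + S')^2) gives the bound
      log det (1 + S') = log det (Cov(mu) L + 1), because t <= 2.
   2. Since t >= 1, the linear estimator g / sqrt t of Y(x) has error covariance at
      most Id, and the posterior covariance is at most that of any estimator.
   3. The mean posterior covariance f(t) at time t is at most Cov(mu), is nonnegative
      and decreases in t at rate at least E [Cov(mu_theta) L Cov(mu_theta) | t]; the
      integral over [1, 2] of this rate is thus at most f(1). To avoid derivatives,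
      the decrease is measured over steps e^2 > 0 (where a linear estimator based on
      one additional observation suffices), and e tends to 0 at the very end. *)

(** The window [1, 2] serves all three bounds: its left end gives the constant in property 2, its
    length the constant in property 3, and its right end is the linear coefficient in (1 + S')^2 = 1
    + 2 S' + S'^2, so that 1 + t S' stays below this square. Gaussian relative entropy carries a
    factor 1/2, which the square absorbs; this is why log det (1 + S') appears without a constant. A
    random time turns the decrease of f into a statement about one mixture, and it costs no
    information, being independent of x. Since mu has only second moments, the sandwiched covariance
    is not known to be integrable beforehand: bounds are first proved for nonnegative extended
    integrals, by Tonelli and monotone convergence, and integrability is read off from them. For
    each fixed theta the posterior density is bounded, so posterior moments exist for every theta,
    not merely almost every one. Spectral theory is avoided: determinants, the factor M and Gaussian
    integrals of quadratic forms come from an induction on Schur complements. *)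

Ltac mfun_step := lazymatch goal with
  | |- measurable_fun _ (fun x => (_ * _)%E) => apply: emeasurable_funM
  | |- measurable_fun _ (fun x => (_ + _)%E) => apply: emeasurable_funD
  | |- measurable_fun _ (fun x => (_)%:E) => apply/measurable_EFinP
  | |- measurable_fun _ (fun x => (_ * _)%R) => apply: measurable_funM
  | |- measurable_fun _ (fun x => (_ - _)%R) => apply: measurable_funB
  | |- measurable_fun _ (fun x => (_ + _)%R) => apply: measurable_funD
  | |- measurable_fun _ (fun x => (- _)%R) => apply: measurable_funN
  | |- measurable_fun _ (fun x => (_ ^+ _)%R) => apply: measurable_funX
  | |- measurable_fun _ (fun x => @expR _ _) => apply: (measurableT_comp (@measurable_expR _))
  | |- measurable_fun _ (fun x => normal_pdf 0 1 _) =>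
      apply: (measurableT_comp (@measurable_normal_pdf _ 0 1))
  | |- measurable_fun _ (@GRing.mul _ _) => exact: mulrl_measurable
  | |- measurable_fun _ (normal_pdf 0 1) => exact: measurable_normal_pdf
  | |- measurable_fun _ expR => exact: measurable_expR
  | |- measurable_fun _ fst => exact: measurable_fst
  | |- measurable_fun _ snd => exact: measurable_snd
  | |- measurable_fun _ (fun x => @abse _ _) => apply: (measurableT_comp (@abse_measurable _ setT))
  | |- measurable_fun _ (fun x => @Num.norm _ _ _) =>
      apply: (measurableT_comp (@normr_measurable _ setT))
  | |- measurable_fun _ (fun x => fst x) => exact: measurable_fst
  | |- measurable_fun _ (fun x => snd x) => exact: measurable_snd
  | |- measurable_fun _ (fun x => fst _) => apply: (measurableT_comp measurable_fst)
  | |- measurable_fun _ (fun x => snd _) => apply: (measurableT_comp measurable_snd)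
  | |- measurable_fun _ (fun x => x) => exact: measurable_id
  | |- measurable_fun _ _ => first [ exact: measurable_cst |
      match goal with H : measurable_fun setT _ |- _ =>
      first [exact: H | apply: (measurableT_comp H)] end ]
  end.
Ltac mfun := solve [repeat mfun_step].
(** * Densities and real integrals *)

Section integral_density.
Import HBNNSimple.
Context {d} {T : measurableType d} {R : realType}.
Variables (nu mu : {measure set T -> \bar R}) (w : T -> R).
Hypothesis dw : is_density nu mu w.
Local Open Scope ereal_scope.

Let mw : measurable_fun setT w. Proof. by case: dw. Qed.
Let w0 x : (0 <= w x)%R. Proof. by case: dw. Qed.
Let muE A : measurable A -> mu A = \int[nu]_(x in A) (w x)%:E.
Proof. by case: dw => _ _; exact. Qed.

(** Monotone convergence along simple functions reduces this to indicators, where it is the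
    definition of a density. This works for an arbitrary [nu], sigma-finite or not. *)
Lemma ge0_integral_density (f : T -> \bar R) :
  measurable_fun setT f -> (forall x, 0 <= f x) ->
  \int[mu]_x f x = \int[nu]_x (f x * (w x)%:E).
Proof.
move=> mf f0; pose h := nnsfun_approx measurableT mf.
have mwE : measurable_fun setT (EFin \o w) by exact/measurable_EFinP.
have fE x : f x = limn (EFin \o h^~ x).
  by apply/esym/cvg_lim => //; exact: cvg_nnsfun_approx.
transitivity (limn (fun n => \int[mu]_x (h n x)%:E)).
  under eq_integral do rewrite fE.
  apply: monotone_convergence => //.
  - by move=> n; exact/measurable_EFinP/measurable_funP.
  - by move=> n x _; rewrite lee_fin.
  - by move=> x _ a b ab; rewrite lee_fin; exact/lefP/nd_nnsfun_approx.
have -> : \int[nu]_x (f x * (w x)%:E) =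
    limn (fun n => \int[nu]_x ((h n x)%:E * (w x)%:E)).
  have fwE x : f x * (w x)%:E = limn (fun n => (h n x)%:E * (w x)%:E).
    by apply/esym/cvg_lim => //; apply: cvgeZr => //; exact: cvg_nnsfun_approx.
  under eq_integral do rewrite fwE.
  apply: monotone_convergence => //.
  - move=> n; apply: emeasurable_funM => //; exact/measurable_EFinP/measurable_funP.
  - by move=> n x _; rewrite mule_ge0 ?lee_fin.
  - move=> x _ a b ab; rewrite lee_wpmul2r ?lee_fin//.
    exact/lefP/nd_nnsfun_approx.
congr (limn _); apply/funext => n.
have hE x : (h n x)%:E = \sum_(y \in range (h n)) (y * \1_(h n @^-1` [set y]) x)%:E.
  by rewrite fimfunE -fsumEFin.
have mind r : measurable_fun setT (fun x => (r * \1_(h n @^-1` [set r]) x)%:E).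
  by apply/measurable_EFinP; exact: measurable_funM.
have hx x y : 0 <= (y * \1_(h n @^-1` [set y]) x)%:E.
  exact: nnfun_muleindic_ge0.
under eq_integral do rewrite hE.
rewrite ge0_integral_fsum//.
under [RHS]eq_integral.
  move=> x _; rewrite hE ge0_mule_fsuml => [|y]; last exact: hx.
  over.
rewrite ge0_integral_fsum//; last 2 first.
  - by move=> y; exact: emeasurable_funM.
  - by move=> y x _; apply: mule_ge0; rewrite ?lee_fin//; exact: hx.
apply: eq_fsbigr => r /[!inE] -[z _ zr].
have r0 : (0 <= r)%R by rewrite -zr.
have mA : measurable (h n @^-1` [set r]) by exact: measurable_sfunP.
under eq_integral do rewrite EFinM.
rewrite ge0_integralZl//; last exact/measurable_EFinP/measurable_indic.
rewrite integral_indic// setIT muE//.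
under [RHS]eq_integral do rewrite EFinM -muleA.
rewrite ge0_integralZl//; last 2 first.
  - by apply: emeasurable_funM => //; exact/measurable_EFinP/measurable_indic.
  - by move=> x _; rewrite mule_ge0 ?lee_fin.
congr (_ * _); rewrite integral_mkcond; apply: eq_integral => x _.
by rewrite patchE indicE; case: ifP => _; rewrite ?mul1e ?mul0e.
Qed.

Lemma integrable_densityP (f : T -> \bar R) : measurable_fun setT f ->
  mu.-integrable setT f <-> nu.-integrable setT (fun x => f x * (w x)%:E).
Proof.
move=> mf.
have E : \int[mu]_x `|f x| = \int[nu]_x `|f x * (w x)%:E|.
  rewrite ge0_integral_density//; last exact: measurableT_comp.
  by apply: eq_integral => x _; rewrite abseM (gee0_abs (x := (w x)%:E)) ?lee_fin.
split=> /integrableP[_ i]; apply/integrableP; split => //.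
- by apply: emeasurable_funM => //; exact/measurable_EFinP.
- by rewrite -E.
- by rewrite E.
Qed.

Lemma integral_density (f : T -> \bar R) : measurable_fun setT f ->
  \int[mu]_x f x = \int[nu]_x (f x * (w x)%:E).
Proof.
move=> mf; rewrite integralE [RHS]integralE.
rewrite !ge0_integral_density//; try exact: measurable_funepos; try exact: measurable_funeneg.
congr (_ - _); apply: eq_integral => x _.
- by rewrite !funeposE maxe_pMl ?mul0e ?lee_fin.
- by rewrite !funenegE -mulNe maxe_pMl ?mul0e ?lee_fin.
Qed.

End integral_density.

Section real_integrable.
Context {d} {T : measurableType d} {R : realType}.
Variable mu : {measure set T -> \bar R}.
Local Notation "''int' f" := (mu.-integrable setT (fun x => (f x)%:E)) (at level 10, f at level 8).
Implicit Types f g : T -> R.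

Lemma rintegrable_measurable f : 'int f -> measurable_fun setT f.
Proof. by move=> /measurable_int /measurable_EFinP. Qed.

Lemma rintegrableD f g : 'int f -> 'int g -> 'int (fun x => f x + g x).
Proof. by move=> fi gi; exact: eq_integrable (integrableD measurableT fi gi). Qed.

Lemma rintegrableB f g : 'int f -> 'int g -> 'int (fun x => f x - g x).
Proof. by move=> fi gi; exact: eq_integrable (integrableB measurableT fi gi). Qed.

Lemma rintegrableZl k f : 'int f -> 'int (fun x => k * f x).
Proof. by move=> fi; exact: eq_integrable (integrableZl measurableT k fi). Qed.

Lemma rintegrable_sum (I : Type) (s : seq I) (P : pred I) (f : I -> T -> R) :
  (forall i, 'int (f i)) -> 'int (fun x => \sum_(i <- s | P i) f i x).
Proof.
move=> fi; have := integrable_sum measurableT s (fun i (_ : P i) => fi i).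
by apply: eq_integrable => // x _; rewrite sumEFin.
Qed.

Lemma Rintegral_sum (I : Type) (s : seq I) (f : I -> T -> R) :
  (forall i, 'int (f i)) ->
  \int[mu]_x (\sum_(i <- s) f i x) = \sum_(i <- s) \int[mu]_x f i x.
Proof.
move=> fi; elim: s => [|i s IH].
  under eq_Rintegral do rewrite big_nil.
  by rewrite big_nil /Rintegral integral0.
under eq_Rintegral do rewrite big_cons.
by rewrite big_cons (RintegralD measurableT (fi i) (rintegrable_sum s xpredT fi)) IH.
Qed.

Lemma le_rintegrable f g : measurable_fun setT f -> (forall x, `|f x| <= g x) ->
  'int g -> 'int f.
Proof.
move=> mf fg; apply: le_integrable => //; first exact/measurable_EFinP.
by move=> x _; rewrite lee_fin (le_trans (fg x))// ler_norm.
Qed.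

Lemma EFin_Rintegral f : 'int f -> (\int[mu]_x f x)%:E = (\int[mu]_x (f x)%:E)%E.
Proof. by move=> fi; rewrite fineK//; exact: integrable_fin_num. Qed.

Lemma ge0_rintegrable f : measurable_fun setT f -> (forall x, 0 <= f x) ->
  (\int[mu]_x (f x)%:E < +oo)%E -> 'int f.
Proof.
move=> mf f0 fi; apply/integrableP; split; first exact/measurable_EFinP.
by under eq_integral do rewrite /= ger0_norm//.
Qed.

End real_integrable.

Lemma rintegrable_cst {d} {T : measurableType d} {R : realType}
    (mu : {finite_measure set T -> \bar R}) (k : R) :
  mu.-integrable setT (fun=> k%:E).
Proof. exact: finite_measure_integrable_cst. Qed.

Lemma Rintegral_cst_probability {d} {T : measurableType d} {R : realType}
    (P : probability T R) (k : R) : \int[P]_x k = k.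
Proof. by rewrite Rintegral_cst// [X in fine X](@probability_setT _ _ _ P) mulr1. Qed.

Section mass1.
Context {d} {T : measurableType d} {R : realType}.
Variable P : {measure set T -> \bar R}.
Hypothesis P1 : P setT = 1%E.

(** Stated for a bare measure of mass 1, which is the form in which the kernel values [mu_ t] occur
    later. *)
Lemma rintegrable_cst_mass1 (k : R) : P.-integrable setT (fun=> k%:E).
Proof.
apply/integrableP; split; first exact: measurable_cst.
by rewrite integral_cst// [X in (_ * X)%E]P1 mule1 ltry.
Qed.

Lemma Rintegral_cst_mass1 (k : R) : \int[P]_x k = k.
Proof. by rewrite Rintegral_cst// [X in fine X]P1 mulr1. Qed.

End mass1.

(** * Gaussian measures *)

Section lebesgue_affine.
Context {R : realType}.
Local Notation lambda := (@lebesgue_measure R).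
Local Open Scope ereal_scope.

(** The image of Lebesgue measure under [a * x + b], scaled by [a], agrees with Lebesgue measure on
    intervals, hence everywhere by uniqueness. *)
Lemma ge0_integral_lebesgue_affine (a b : R) (F : R -> \bar R) : (0 < a)%R ->
  measurable_fun setT F -> (forall x, 0 <= F x) ->
  \int[lambda]_x F x = a%:E * \int[lambda]_x F (a * x + b)%R.
Proof.
move=> a0 mF F0; pose phi (x : measurableTypeR R) : measurableTypeR R := (a * x + b)%R.
have mphi : measurable_fun [set: measurableTypeR R] phi.
  by apply: measurable_funD => //; exact: measurable_funM.
have a0' : (0 <= a)%R by exact: ltW.
pose push : {measure set (measurableTypeR R) -> \bar R} :=
  measure_function_pushforward__canonical__measure_function_Measure lambda mphi.
pose m' : {measure set (measurableTypeR R) -> \bar R} := mscale (NngNum a0') push.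
have E A : measurable A -> lambda A = m' A.
  apply: lebesgue_measure_unique => _ [[u v] _ <-].
  rewrite /m' /= /mscale /= /pushforward.
  have -> : phi @^-1` `]u, v]%classic = `]((u - b) / a)%R, ((v - b) / a)%R]%classic.
    apply/seteqP; split => x /=; rewrite !in_itv/= /phi.
      by rewrite ltr_pdivrMr// ler_pdivlMr// ltrBlDr lerBrDr (mulrC x).
    by rewrite ltr_pdivrMr// ler_pdivlMr// ltrBlDr lerBrDr (mulrC x).
  rewrite !lebesgue_measure_itv/= !lte_fin ltr_pM2r ?invr_gt0// ltrD2r.
  case: ifPn => uv; last by rewrite mule0.
  by rewrite -!EFinB -EFinM; congr EFin; field; rewrite gt_eqF.
rewrite (eq_measure_integral m')/=; last by move=> A mA _; exact: E.
by rewrite ge0_integral_mscale//= ge0_integral_pushforward.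
Qed.

Lemma ge0_integral_lebesgue_translation (b : R) (F : R -> \bar R) :
  measurable_fun setT F -> (forall x, 0 <= F x) ->
  \int[lambda]_x F (x + b)%R = \int[lambda]_x F x.
Proof.
move=> mF F0; rewrite [RHS](ge0_integral_lebesgue_affine b ltr01)// mul1e.
by apply: eq_integral => x _; rewrite mul1r.
Qed.

End lebesgue_affine.

Section gauss1.
Context {R : realType}.
Local Notation lambda := (@lebesgue_measure R).
Local Notation gamma1 := (normal_prob (0 : R) 1).

Lemma normal_pdf01E x : normal_pdf 0 1 x = normal_peak 1 * expR (- (x ^+ 2) / 2) :> R.
Proof.
by rewrite normal_pdfE ?oner_neq0// /normal_fun subr0 expr1n.
Qed.

Lemma is_density_gamma1 : is_density lambda gamma1 (normal_pdf 0 1).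
Proof.
split=> [|x|//]; [exact: measurable_normal_pdf|exact: normal_pdf_ge0].
Qed.

Local Open Scope ereal_scope.

(** Completing the square: times the standard density, the integrand is a multiple of the normal
    density of mean [b / c] and variance [1 / c]. The moments, the rotation invariance and the
    quadratic integrals below all rest on this formula. *)
Lemma integral_gauss1_expR (c b : R) : (0 < c)%R ->
  \int[gamma1]_x (expR ((1 - c) * x ^+ 2 / 2 + b * x))%:E =
  ((Num.sqrt c)^-1 * expR (b ^+ 2 / (2 * c)))%:E.
Proof.
move=> c0; have sc0 : (0 < Num.sqrt c)%R by rewrite sqrtr_gt0.
have scs : (Num.sqrt c ^+ 2 = c)%R by rewrite sqr_sqrtr// ltW.
rewrite (ge0_integral_density is_density_gamma1); last 2 first.
- apply/measurable_EFinP/measurableT_comp => //; apply: measurable_funD.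
    by apply: measurable_funM => //; apply: measurable_funM.
  exact: measurable_funM.
- by move=> x; rewrite lee_fin expR_ge0.
have nz : ((Num.sqrt c)^-1 != 0)%R by rewrite invr_neq0// gt_eqF.
transitivity (\int[lambda]_x (((Num.sqrt c)^-1 * expR (b ^+ 2 / (2 * c)))%:E *
    (normal_pdf (b / c) (Num.sqrt c)^-1 x)%:E)).
  apply: eq_integral => x _; rewrite -!EFinM; congr EFin.
  rewrite normal_pdf01E normal_pdfE// /normal_fun.
  have -> : normal_peak (Num.sqrt c)^-1 = (Num.sqrt c * normal_peak 1 :> R)%R.
    rewrite /normal_peak expr1n exprVn scs mul1r -mulrnAr sqrtrM ?invr_ge0 ?ltW//.
    by rewrite invfM sqrtrV ?ltW// invrK.
  rewrite mulrCA [RHS]mulrACA mulKf ?gt_eqF//.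
  rewrite -mulrA [in RHS](mulrC (expR _)) -mulrA; congr *%R.
  rewrite -expRD mulrC -expRD; congr expR.
  rewrite exprVn scs; field; rewrite gt_eqF//=.
rewrite ge0_integralZl//; [|by apply/measurable_EFinP; exact: measurable_normal_pdf|
  by move=> x _; rewrite lee_fin normal_pdf_ge0].
by rewrite integral_normal_pdf mule1.
Qed.

(** The Cameron-Martin formula in dimension one, from translation invariance of Lebesgue measure. *)
Lemma integral_gauss1_shift (c : R) (F : R -> \bar R) :
  measurable_fun setT F -> (forall x, 0 <= F x) ->
  \int[gamma1]_x ((expR (c * x - c ^+ 2 / 2))%:E * F x) = \int[gamma1]_x F (x + c)%R.
Proof.
move=> mF F0.
rewrite [LHS](ge0_integral_density is_density_gamma1)//;
  [|mfun|by move=> x; rewrite mule_ge0 ?lee_fin ?expR_ge0 ?normal_pdf_ge0].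
rewrite [RHS](ge0_integral_density is_density_gamma1)//; last mfun.
rewrite -[RHS](ge0_integral_lebesgue_translation (- c)%R);
  [|mfun|by move=> x; rewrite mule_ge0 ?lee_fin ?expR_ge0 ?normal_pdf_ge0].
apply: eq_integral => x _; rewrite subrK.
rewrite muleAC muleC; congr *%E; rewrite -EFinM !normal_pdf01E; congr EFin.
by rewrite mulrC -mulrA -expRD; congr (_ * expR _)%R; field.
Qed.

(** Substituting [s = a * x + b * y] for [y], which uses [b > 0], and exchanging the integrals
    leaves a Gaussian integral in [x] that evaluates to the standard density at [s]. *)
Lemma integral_gauss1_rotation (a b : R) (F : R -> \bar R) :
  (a ^+ 2 + b ^+ 2 = 1)%R -> (0 < b)%R ->
  measurable_fun setT F -> (forall x, 0 <= F x) ->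
  \int[gamma1]_x \int[gamma1]_y F (a * x + b * y)%R = \int[gamma1]_x F x.
Proof.
move=> ab b0 mF F0; have a2 : (a ^+ 2 = 1 - b ^+ 2)%R by rewrite -ab addrK.
have bi0 : (0 <= b^-1)%R by rewrite invr_ge0 ltW.
transitivity (\int[gamma1]_x \int[lambda]_s
    (F s * ((b^-1)%:E * (normal_pdf 0 1 ((s - a * x) / b))%:E))).
  apply: eq_integral => x _.
  rewrite (ge0_integral_density is_density_gamma1)//; last mfun.
  rewrite [RHS](ge0_integral_lebesgue_affine (a * x)%R b0);
    [|mfun|by move=> s; rewrite !mule_ge0 ?lee_fin ?normal_pdf_ge0].
  rewrite -ge0_integralZl ?lee_fin ?(ltW b0)//;
    [|mfun|by move=> s _; rewrite !mule_ge0 ?lee_fin ?normal_pdf_ge0].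
  apply: eq_integral => y _.
  rewrite addrK (mulrC b y) mulfK ?gt_eqF// addrC.
  by rewrite [RHS]muleCA; congr *%E; rewrite -!EFinM mulrA divff ?gt_eqF// mul1r.
rewrite (@fubini_tonelli _ _ _ _ _ gamma1 lambda (fun z : R * R => (F z.2 *
   ((b^-1)%:E * (normal_pdf 0 1 ((z.2 - a * z.1) / b))%:E))))/=;
  [|mfun|by move=> z; rewrite !mule_ge0 ?lee_fin ?normal_pdf_ge0].
rewrite (ge0_integral_density is_density_gamma1)//.
apply: eq_integral => s _.
rewrite ge0_integralZl//; [|mfun|by move=> x _; rewrite mule_ge0 ?lee_fin ?normal_pdf_ge0].
congr *%E.
have c0 : (0 < (b ^+ 2)^-1)%R by rewrite invr_gt0 exprn_gt0.
have k0 : (0 <= b^-1 * (normal_peak 1 * expR (- s ^+ 2 / (2 * b ^+ 2))))%R.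
  by rewrite !mulr_ge0 ?expR_ge0 ?normal_peak_ge0.
transitivity ((b^-1 * (normal_peak 1 * expR (- s ^+ 2 / (2 * b ^+ 2))))%:E *
  \int[gamma1]_x (expR ((1 - (b ^+ 2)^-1) * x ^+ 2 / 2 + (s * a / b ^+ 2) * x))%:E).
  rewrite -ge0_integralZl//; [|mfun].
  apply: eq_integral => x _; rewrite -!EFinM; congr EFin.
  rewrite -!mulrA; congr *%R; rewrite normal_pdf01E; congr *%R.
  rewrite -expRD; congr expR.
  have -> : (1 - (b ^+ 2)^-1 = - (a ^+ 2 / b ^+ 2))%R.
    by rewrite a2; field; rewrite gt_eqF.
  by field; rewrite gt_eqF.
rewrite integral_gauss1_expR// -EFinM; congr EFin.
rewrite normal_pdf01E sqrtrV ?sqr_ge0// sqrtr_sqr gtr0_norm// invrK.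
have K (u v w : R) : (b^-1 * (u * v) * (b * w) = u * (v * w))%R.
  by field; rewrite gt_eqF.
rewrite K -expRD; congr (_ * expR _)%R.
have -> : ((s * a / b ^+ 2) ^+ 2 = s ^+ 2 * (1 - b ^+ 2) / b ^+ 4)%R.
  by rewrite -a2; field; rewrite gt_eqF.
by field; rewrite gt_eqF.
Qed.
End gauss1.

Section gauss1_moments.
Context {R : realType}.
Local Notation gamma1 := (normal_prob (0 : R) 1).

(** Domination by [4 * expR (x ^+ 2 / 4)], whose integral is the exponential formula at [c = 1 / 2],
    [b = 0]. *)
Lemma integrable_gauss1_sqr : gamma1.-integrable setT (fun x : R => (x ^+ 2)%:E).
Proof.
have h : (0 < 1 / 2 :> R) by rewrite divr_gt0.
have E := integral_gauss1_expR 0 h.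
apply/integrableP; split; first by mfun.
apply: (@le_lt_trans _ _ (\int[gamma1]_x (4%:E *
    (expR ((1 - 1 / 2) * x ^+ 2 / 2 + 0 * x))%:E))%E); last first.
  rewrite ge0_integralZl//; last by mfun.
  by rewrite E -EFinM ltry.
apply: ge0_le_integral => //; [by mfun|by mfun|].
move=> x _; rewrite /= ger0_norm ?sqr_ge0// -EFinM lee_fin.
have := expR_ge1Dx ((1 - 1 / 2) * x ^+ 2 / 2 + 0 * x); lra.
Qed.

Lemma integrable_gauss1_id : gamma1.-integrable setT (fun x : R => x%:E).
Proof.
have i1 : gamma1.-integrable setT (fun x : R => (1 + x ^+ 2)%:E).
  exact: (rintegrableD (rintegrable_cst gamma1 1) integrable_gauss1_sqr).
apply: le_rintegrable i1; first by mfun.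
by move=> x; rewrite ler_norml; apply/andP; split; nra.
Qed.

Let m1 : R := \int[gamma1]_x x.
Let m2 : R := \int[gamma1]_x (x ^+ 2).

(* [1 + y <= expR y], integrated against [gamma1], bounds the moments by the
   Laplace transform; choosing [b] and [c] well then determines them. *)
Let moments_ub (c b : R) : 0 < c ->
  1 + (1 - c) / 2 * m2 + b * m1 <= (Num.sqrt c)^-1 * expR (b ^+ 2 / (2 * c)).
Proof.
move=> c0; have E := integral_gauss1_expR b c0.
have ie : gamma1.-integrable setT (fun x => (expR ((1 - c) * x ^+ 2 / 2 + b * x))%:E).
  apply/integrableP; split; first by mfun.
  under eq_integral do rewrite /= ger0_norm ?expR_ge0//.
  by rewrite E ltry.
have <- : \int[gamma1]_x expR ((1 - c) * x ^+ 2 / 2 + b * x) =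
    (Num.sqrt c)^-1 * expR (b ^+ 2 / (2 * c)) by rewrite /Rintegral E.
have i1 := rintegrableZl ((1 - c) / 2) integrable_gauss1_sqr.
have i2 := rintegrableZl b integrable_gauss1_id.
have i0 := rintegrable_cst gamma1 1.
have <- : \int[gamma1]_x (1 + (1 - c) / 2 * x ^+ 2 + b * x) =
    1 + (1 - c) / 2 * m2 + b * m1.
  rewrite RintegralD//; last exact: rintegrableD.
  rewrite RintegralD// (Rintegral_cst_probability gamma1).
  by rewrite !RintegralZl//; [exact: integrable_gauss1_sqr|exact: integrable_gauss1_id].
apply: le_Rintegral => //.
  by apply: rintegrableD => //; apply: rintegrableD.
move=> x _; have := expR_ge1Dx ((1 - c) * x ^+ 2 / 2 + b * x); lra.
Qed.

Lemma gauss1_mean : m1 = 0.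
Proof.
apply/eqP; apply: contraT => m0.
have m1s : 0 < m1 ^+ 2 by rewrite exprn_even_gt0.
(* The bound at [c = 1] and a small [b] of the sign of [m1] is violated to first order in [b]. With
   [b = t * m1] for this [t] one has [t * m1 ^+ 2 = 1 - t], and the contradiction is polynomial in
   [t]. *)
pose t := (1 + m1 ^+ 2)^-1; have t0 : 0 < t by rewrite invr_gt0; lra.
have tE : t * (1 + m1 ^+ 2) = 1 by rewrite mulVf// gt_eqF//; lra.
have := moments_ub (t * m1) ltr01.
rewrite subrr mul0r mul0r addr0 sqrtr1 invr1 mul1r mulr1.
have := expR_ge1Dx (- ((t * m1) ^+ 2 / 2)); rewrite expRN => h1 h2.
set e := expR _ in h1 h2; have e0 : 0 < e by exact: expR_gt0.
have h3 : (1 - (t * m1) ^+ 2 / 2) * e <= 1 by rewrite -ler_pdivlMr// mul1r.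
have q : t * m1 ^+ 2 = 1 - t by lra.
have h4 : (t * m1) ^+ 2 = t * (1 - t) by rewrite -q; ring.
have h5 : t * m1 * m1 = 1 - t by rewrite -q; ring.
have t1 : t < 1 by nra.
rewrite h4 in h3; rewrite h5 in h2.
nra.
Qed.

Lemma gauss1_moment2 : m2 = 1.
Proof.
have m20 : 0 <= m2 by apply: Rintegral_ge0 => x _; exact: sqr_ge0.
(* This is the bound at [c = s ^- 2], [b = 0]. After division by [s - 1] it bounds [m2] by
   [2 * s ^+ 2 / (s + 1)], from above if [s > 1] and from below if [s < 1]; both sides tend to 1
   with [s]. The values [1 + e] and [1 - f] below are close enough to 1 to contradict [m2 != 1]. *)
have H (s : R) : 0 < s -> (s ^+ 2 - 1) * m2 <= 2 * s ^+ 2 * (s - 1).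
  move=> s0; have c0 : 0 < (s ^+ 2)^-1 by rewrite invr_gt0 exprn_gt0.
  have := moments_ub 0 c0.
  rewrite mul0r addr0 expr0n/= mul0r expR0 mulr1 sqrtrV ?sqr_ge0// sqrtr_sqr gtr0_norm// invrK.
  have ss : s ^+ 2 * (s ^+ 2)^-1 = 1 by rewrite divff// gt_eqF// exprn_gt0.
  set u := (s ^+ 2)^-1 in ss c0 *; have s20 : 0 < s ^+ 2 by rewrite exprn_gt0.
  set w := s ^+ 2 in ss s20 *. move=> h.
  have : w * (1 + (1 - u) / 2 * m2) <= w * s by rewrite ler_pM2l.
  have -> : w * (1 + (1 - u) / 2 * m2) = w + (w - w * u) / 2 * m2 by ring.
  rewrite ss; lra.
apply/eqP; rewrite eq_le; apply/andP; split; rewrite leNgt; apply/negP => h.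
- pose e := (m2 - 1) / (m2 + 5).
  have d : 0 < m2 + 5 by lra.
  have eE : e * (m2 + 5) = m2 - 1 by rewrite divfK// gt_eqF.
  have e0 : 0 < e by rewrite divr_gt0//; lra.
  have e1 : e < 1 by rewrite ltr_pdivrMr//; lra.
  have s0 : 0 < 1 + e by lra.
  have := H _ s0; nra.
- pose f := (1 - m2) / 4; have f0 : 0 < f by rewrite /f; lra.
  have s0 : 0 < 1 - f by rewrite /f; lra.
  have fE : m2 = 1 - 4 * f by rewrite /f; lra.
  have := H _ s0; rewrite fE; nra.
Qed.

Lemma integral_gauss1_sqr (b c : R) :
  (\int[gamma1]_x ((b + c * x) ^+ 2)%:E = (b ^+ 2 + c ^+ 2)%:E)%E.
Proof.
have i1 := rintegrableZl (c ^+ 2) integrable_gauss1_sqr.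
have i2 := rintegrableZl (2 * b * c) integrable_gauss1_id.
have i0 := rintegrable_cst gamma1 (b ^+ 2).
have fE x : (b + c * x) ^+ 2 = b ^+ 2 + 2 * b * c * x + c ^+ 2 * x ^+ 2 by ring.
have i3 : gamma1.-integrable setT (fun x : R => ((b + c * x) ^+ 2)%:E).
  apply: eq_integrable (rintegrableD (rintegrableD i0 i2) i1) => //.
  by move=> x _ /=; rewrite fE.
rewrite -[LHS]fineK ?integrable_fin_num//; congr EFin.
rewrite -[LHS]/(Rintegral gamma1 setT (fun x => (b + c * x) ^+ 2)).
under eq_Rintegral do rewrite fE.
rewrite RintegralD//; last exact: rintegrableD.
rewrite RintegralD// (Rintegral_cst_probability gamma1).
rewrite !RintegralZl//; [|exact: integrable_gauss1_sqr|exact: integrable_gauss1_id].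
by rewrite -/m1 -/m2 gauss1_mean gauss1_moment2 mulr0 addr0 mulr1.
Qed.

End gauss1_moments.

(** * Vectors as tuples and the standard Gaussian law on R^n *)

Section tuple_vectors.
Context {R : realType}.

Definition dotp n (g h : n.-tuple R) : R := \sum_i tnth g i * tnth h i.

Definition combt n (a : R) (g : n.-tuple R) (b : R) (h : n.-tuple R) : n.-tuple R :=
  [tuple a * tnth g i + b * tnth h i | i < n].

Definition tcons n (x : R) (g : n.-tuple R) : n.+1.-tuple R := [tuple of x :: g].

Lemma dotp_cons n x y (g h : n.-tuple R) :
  dotp (tcons x g) (tcons y h) = x * y + dotp g h.
Proof.
rewrite /dotp big_ord_recl !tnth0; congr +%R.
by apply: eq_bigr => i _; rewrite !tnthS.
Qed.

Lemma combt_cons n a x (g : n.-tuple R) b y (h : n.-tuple R) :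
  combt a (tcons x g) b (tcons y h) = tcons (a * x + b * y) (combt a g b h).
Proof.
apply: eq_from_tnth => i; rewrite tnth_mktuple.
have [j ->|->] := unliftP ord0 i; last by rewrite !tnth0.
by rewrite !tnthS tnth_mktuple.
Qed.

Lemma dotp_ge0 n (g : n.-tuple R) : 0 <= dotp g g.
Proof. by apply: sumr_ge0 => i _; rewrite -expr2 sqr_ge0. Qed.

Lemma dotpC n (g h : n.-tuple R) : dotp g h = dotp h g.
Proof. by apply: eq_bigr => i _; rewrite mulrC. Qed.

Lemma dotp_combl n a (g : n.-tuple R) b h k :
  dotp (combt a g b h) k = a * dotp g k + b * dotp h k.
Proof.
rewrite /dotp !mulr_sumr -big_split; apply: eq_bigr => i _ /=.
by rewrite tnth_mktuple mulrDl !mulrA.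
Qed.

Lemma dotp_combr n a (g : n.-tuple R) b h k :
  dotp k (combt a g b h) = a * dotp k g + b * dotp k h.
Proof. by rewrite dotpC dotp_combl !(dotpC k). Qed.

Lemma measurable_dotp d (T : measurableType d) n (f g : T -> n.-tuple R) :
  measurable_fun setT f -> measurable_fun setT g ->
  measurable_fun setT (fun x => dotp (f x) (g x)).
Proof.
move=> mf mg; apply: measurable_sum => i; apply: measurable_funM.
- by apply: (measurableT_comp (measurable_tnth i)).
- by apply: (measurableT_comp (measurable_tnth i)).
Qed.

Lemma measurable_tcons d (T : measurableType d) n (f : T -> R) (g : T -> n.-tuple R) :
  measurable_fun setT f -> measurable_fun setT g ->
  measurable_fun setT (fun x => tcons (f x) (g x)).
Proof. exact: measurable_cons. Qed.

Lemma measurable_combt d (T : measurableType d) n (a b : R) (f g : T -> n.-tuple R) :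
  measurable_fun setT f -> measurable_fun setT g ->
  measurable_fun setT (fun x => combt a (f x) b (g x)).
Proof.
move=> mf mg; apply/measurable_fun_tnthP => i.
rewrite [X in measurable_fun _ X](_ : _ = fun x => a * tnth (f x) i + b * tnth (g x) i).
  apply: measurable_funD; apply: measurable_funM => //;
    exact: (measurableT_comp (measurable_tnth i)).
by apply/funext => x /=; rewrite tnth_mktuple.
Qed.

End tuple_vectors.

Ltac vfun_step := lazymatch goal with
  | |- measurable_fun _ (fun x => dotp _ _) => apply: measurable_dotp
  | |- measurable_fun _ (dotp ?c) => apply: (@measurable_dotp _ _ _ _ (fun=> c) id)
  | |- measurable_fun _ (tcons ?c) => apply: (@measurable_tcons _ _ _ _ (fun=> c) id)
  | |- measurable_fun _ (combt ?a ?c ?b) => apply: (@measurable_combt _ _ _ _ a b (fun=> c) id)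
  | |- measurable_fun _ id => exact: measurable_id
  | |- measurable_fun _ (fun x => combt _ _ _ _) => apply: measurable_combt
  | |- measurable_fun _ (fun x => tcons _ _) => apply: measurable_tcons
  | |- _ => mfun_step
  end.
Ltac vfun := solve [repeat vfun_step].

Section gauss.
Context {R : realType}.
Local Notation gamma1 := (normal_prob (0 : R) 1).

Section gauss_cons.
Context {n : nat} (P : probability (n.-tuple R) R).

Let consf (z : measurableTypeR R * n.-tuple R) : n.+1.-tuple R := tcons z.1 z.2.

Let mconsf : measurable_fun setT consf.
Proof.
apply: measurable_cons; last exact: measurable_snd.
exact: measurable_fst.
Qed.

Definition gauss_cons : set (n.+1.-tuple R) -> \bar R :=
  pushforward (gamma1 \x P)%E consf.

HB.instance Definition _ := Measure.copy gauss_cons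
  (measure_function_pushforward__canonical__measure_function_Measure (gamma1 \x P)%E mconsf).

Let gauss_cons_setT : gauss_cons setT = 1%E.
Proof. by rewrite /gauss_cons /pushforward preimage_setT; exact: probability_setT. Qed.

HB.instance Definition _ := Measure_isProbability.Build _ _ _ gauss_cons gauss_cons_setT.

Lemma ge0_integral_gauss_cons (F : n.+1.-tuple R -> \bar R) :
  measurable_fun setT F -> (forall x, 0 <= F x)%E ->
  (\int[gauss_cons]_x F x =
   \int[gamma1]_x \int[P]_y F (tcons x y))%E.
Proof.
move=> mF F0; rewrite ge0_integral_pushforward//=.
by rewrite fubini_tonelli1//=; exact: measurableT_comp.
Qed.

End gauss_cons.

(** The recursion on the dimension makes each integral an iterated one, so that Gaussian identities
    follow from dimension one by induction. *)
Fixpoint gauss n : probability (n.-tuple R) R :=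
  match n with
  | 0 => dirac [tuple]
  | n'.+1 => gauss_cons (gauss n')
  end.

Local Open Scope ereal_scope.

Lemma ge0_integral_gaussS n (F : n.+1.-tuple R -> \bar R) :
  measurable_fun setT F -> (forall x, 0 <= F x) ->
  \int[gauss n.+1]_x F x = \int[gamma1]_x \int[gauss n]_y F (tcons x y).
Proof. exact: ge0_integral_gauss_cons. Qed.

Lemma integral_gauss0 (F : 0.-tuple R -> \bar R) :
  measurable_fun setT F -> \int[gauss 0]_x F x = F [tuple].
Proof. by move=> mF; rewrite integral_dirac// diracT mul1e. Qed.

Lemma measurable_integral_gauss d (T : measurableType d) n (F : T * n.-tuple R -> \bar R) :
  measurable_fun setT F -> (forall z, 0 <= F z) ->
  measurable_fun setT (fun x => \int[gauss n]_y F (x, y)).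
Proof. exact: measurable_fun_fubini_tonelli_F. Qed.

(** The Cameron-Martin formula: the exponential weight factors over the coordinates. *)
Lemma integral_gauss_shift n (c : n.-tuple R) (F : n.-tuple R -> \bar R) :
  measurable_fun setT F -> (forall x, 0 <= F x) ->
  \int[gauss n]_x ((expR (dotp c x - dotp c c / 2))%:E * F x) =
  \int[gauss n]_x F (combt 1 x 1 c).
Proof.
elim: n => [|n IH] in c F *; move=> mF F0.
  rewrite !integral_gauss0; [|vfun|vfun].
  rewrite /dotp !big_ord0 mul0r subrr expR0 mul1e.
  by congr F; rewrite [RHS]tuple0.
case/tupleP: c => c0 c; rewrite -/(tcons c0 c).
rewrite [LHS]ge0_integral_gaussS; [|vfun|by move=> x; rewrite mule_ge0 ?lee_fin ?expR_ge0].
rewrite [RHS]ge0_integral_gaussS; [|vfun|by []].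
pose G x := \int[gauss n]_y F (tcons x (combt 1 y 1 c)).
have mG : measurable_fun setT G.
  apply: (measurable_integral_gauss (F := fun z => F (tcons z.1 (combt 1 z.2 1 c)))) => //.
  vfun.
have G0 x : 0 <= G x by apply: integral_ge0.
transitivity (\int[gamma1]_x ((expR (c0 * x - c0 ^+ 2 / 2))%:E * G x)); last first.
  rewrite (integral_gauss1_shift _ mG G0); apply: eq_integral => x _.
  by apply: eq_integral => y _; rewrite combt_cons !mul1r.
apply: eq_integral => x _.
rewrite /G -(IH c (fun y => F (tcons x y)))//; last vfun.
rewrite -ge0_integralZl//; [|vfun|by move=> y _; rewrite mule_ge0 ?lee_fin ?expR_ge0].
apply: eq_integral => y _; rewrite muleA -EFinM -expRD !dotp_cons.
by congr ((expR _)%:E * _); lra.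
Qed.

(** Tonelli exchanges the tail of the first vector with the head of the second; the heads are then
    handled by the one-dimensional case and the tails by induction. *)
Lemma integral_gauss_rotation n (a b : R) (F : n.-tuple R -> \bar R) :
  (a ^+ 2 + b ^+ 2 = 1)%R -> (0 < b)%R ->
  measurable_fun setT F -> (forall x, 0 <= F x) ->
  \int[gauss n]_x \int[gauss n]_y F (combt a x b y) = \int[gauss n]_x F x.
Proof.
move=> ab b0; elim: n => [|n IH] in F *; move=> mF F0.
  rewrite integral_gauss0; last first.
    apply: (measurable_integral_gauss (F := fun z => F (combt a z.1 b z.2))) => //.
    vfun.
  rewrite !integral_gauss0; [|vfun|vfun].
  by congr F; rewrite tuple0.
rewrite [RHS]ge0_integral_gaussS//.
rewrite ge0_integral_gaussS; last 2 first.
- apply: (measurable_integral_gauss (F := fun z => F (combt a z.1 b z.2))) => //.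
  vfun.
- by move=> x; exact: integral_ge0.
pose G s := \int[gauss n]_y F (tcons s y).
have mG : measurable_fun setT G.
  apply: (measurable_integral_gauss (F := fun z => F (tcons z.1 z.2))) => //.
  vfun.
have G0 x : 0 <= G x by apply: integral_ge0.
rewrite -[RHS](integral_gauss1_rotation ab b0 mG G0).
apply: eq_integral => x _.
transitivity (\int[gauss n]_y \int[gamma1]_x' \int[gauss n]_y'
    F (tcons (a * x + b * x')%R (combt a y b y'))).
  apply: eq_integral => y _; rewrite ge0_integral_gaussS; [|vfun|by []].
  apply: eq_integral => x' _; apply: eq_integral => y' _.
  by rewrite combt_cons.
rewrite (@fubini_tonelli _ _ _ _ _ (gauss n) gamma1 (fun z => \int[gauss n]_y'
    F (tcons (a * x + b * z.2)%R (combt a z.1 b y'))))/=; last 2 first.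
- apply: (measurable_integral_gauss (F := fun u =>
    F (tcons (a * x + b * u.1.2)%R (combt a u.1.1 b u.2)))) => //.
  vfun.
- by move=> z; exact: integral_ge0.
apply: eq_integral => x' _.
by rewrite (IH (fun y => F (tcons (a * x + b * x')%R y)))//; vfun.
Qed.

Lemma integral_gauss_sqr n (b : R) (c : n.-tuple R) :
  \int[gauss n]_x ((b + dotp c x) ^+ 2)%:E = (b ^+ 2 + dotp c c)%:E.
Proof.
elim: n => [|n IH] in b c *.
  rewrite integral_gauss0; last vfun.
  by rewrite /dotp !big_ord0 !addr0.
case/tupleP: c => c0 c; rewrite -/(tcons c0 c).
rewrite ge0_integral_gaussS; [|vfun|by move=> x; rewrite lee_fin sqr_ge0].
transitivity (\int[gamma1]_x (((b + c0 * x) ^+ 2)%:E + (dotp c c)%:E)).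
  apply: eq_integral => x _; rewrite -EFinD -(IH (b + c0 * x)%R).
  by apply: eq_integral => y _; rewrite dotp_cons addrA.
rewrite ge0_integralD//; [|by move=> x _; rewrite lee_fin sqr_ge0|vfun|
  by move=> x _; rewrite lee_fin dotp_ge0].
rewrite integral_gauss1_sqr integral_cst// [X in _ + _ * X](@probability_setT _ _ _ gamma1).
by rewrite mule1 -EFinD dotp_cons -addrA.
Qed.

End gauss.

(** * Positive definite matrices *)

Section schur_complement.
Context {R : realType}.

Definition qform n (A : 'M[R]_n) (v : 'cV[R]_n) : R := (v^T *m A *m v) 0 0.

(* One step of the Cholesky factorization: every positive definite matrix is of
   this form, with [S] its Schur complement. *)
Definition schur n (c : R) (r : 'rV[R]_n) (S : 'M[R]_n) : 'M[R]_(1 + n) :=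
  block_mx c%:M r r^T (S + c^-1 *: (r^T *m r)).

Lemma qform_block n c (r : 'rV[R]_n) (A : 'M[R]_n) x (w : 'cV[R]_n) :
  qform (block_mx c%:M r r^T A) (col_mx x%:M w) =
  c * x ^+ 2 + 2 * x * (r *m w) 0 0 + qform A w.
Proof.
rewrite /qform tr_col_mx tr_scalar_mx mul_row_block mul_row_col !mulmxDl.
rewrite -!scalar_mxM !mul_scalar_mx -!scalemxAl !mxE /= mulr1n.
have E : (w^T *m r^T) 0 0 = \sum_j r 0 j * w j 0 by rewrite -trmx_mul !mxE.
by rewrite big_ord1 E [_%:M 0 0]mxE mulr1n; ring.
Qed.

Lemma qformD n (A B : 'M[R]_n) v : qform (A + B) v = qform A v + qform B v.
Proof. by rewrite /qform mulmxDr mulmxDl mxE. Qed.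

Lemma qformZ n k (A : 'M[R]_n) v : qform (k *: A) v = k * qform A v.
Proof. by rewrite /qform -scalemxAr -scalemxAl mxE. Qed.

Lemma qformB n (A B : 'M[R]_n) v : qform (A - B) v = qform A v - qform B v.
Proof. by rewrite -scaleN1r qformD qformZ mulN1r. Qed.

Lemma qform_gram n p (M : 'M[R]_(p, n)) (v : 'cV[R]_n) :
  qform (M^T *m M) v = \sum_i ((M *m v) i 0) ^+ 2.
Proof.
rewrite /qform mulmxA -mulmxA -trmx_mul mxE.
by apply: eq_bigr => i _; rewrite mxE expr2.
Qed.

Lemma qform_schur n c (r : 'rV[R]_n) (S : 'M[R]_n) x (w : 'cV[R]_n) : c != 0 ->
  qform (schur c r S) (col_mx x%:M w) =
  c * (x + c^-1 * (r *m w) 0 0) ^+ 2 + qform S w.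
Proof.
move=> c0; rewrite qform_block qformD qformZ qform_gram big_ord1.
by field.
Qed.

Lemma det_schur n c (r : 'rV[R]_n) (S : 'M[R]_n) : c != 0 ->
  \det (schur c r S) = c * \det S.
Proof.
move=> c0.
have -> : schur c r S = block_mx 1%:M 0 (c^-1 *: r^T) 1%:M *m block_mx c%:M r 0 S.
  rewrite /schur mulmx_block !mul1mx !mul0mx !addr0; congr block_mx.
    by rewrite mul_mx_scalar scalerA divff// scale1r.
  by rewrite scalemxAl addrC.
by rewrite det_mulmx det_lblock det_ublock !det1 !mul1r det_scalar1.
Qed.

Lemma posdefmx_schur n (A : 'M[R]_(1 + n)) : posdefmx A ->
  exists c r S, [/\ 0 < c, posdefmx S & A = schur c r S].
Proof.
move=> [As Ap]; pose c := A 0 0; pose r := ursubmx A.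
pose S := drsubmx A - c^-1 *: (r^T *m r).
have cE : ulsubmx A = c%:M.
  rewrite [LHS]mx11_scalar; congr (_ %:M); rewrite !mxE /c.
  by congr (A _ _); exact: val_inj.
have rE : dlsubmx A = r^T by rewrite /r trmx_ursub As.
have AE : A = schur c r S.
  by rewrite -[A]submxK cE rE /schur /S subrK.
have c0 : 0 < c.
  have := Ap (col_mx 1%:M 0).
  have -> : (col_mx 1%:M 0 : 'cV[R]_(1 + n)) != 0.
    apply/eqP => /(congr1 (@usubmx _ 1 n 1)); rewrite col_mxKu linear0.
    by move=> /matrixP/(_ 0 0)/eqP; rewrite !mxE oner_eq0.
  move=> /(_ isT); rewrite -/(qform A _) -{1}[A]submxK cE rE qform_block.
  by rewrite /qform !mulmx0 !mxE expr1n mulr1 mulr0 !addr0.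
exists c, r, S; split=> //; split.
  rewrite /S linearB linearZ /= trmx_mul trmxK; congr (_ - _).
  by rewrite trmx_drsub As.
move=> w w0; rewrite -/(qform S w).
(* For a given [w], this first coordinate minimizes the quadratic form of [A], and the minimum is
   [qform S w]. *)
have v0 : (col_mx (- (c^-1 * (r *m w) 0 0))%:M w : 'cV[R]_(1 + n)) != 0.
  apply: contraNneq w0 => /(congr1 (@dsubmx _ 1 n 1)).
  by rewrite col_mxKd linear0 => ->.
have := Ap _ v0; rewrite -/(qform A _) {1}AE qform_schur ?gt_eqF//.
by rewrite addNr expr0n mulr0 add0r.
Qed.

(** Induction on Schur complements stands in for diagonalization: determinant, factorization, trace
    inequality and Gaussian integral are all obtained from it. *)
Lemma posdefmx_ind (P : forall n, 'M[R]_n -> Prop) :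
  (forall A : 'M[R]_0, P 0%N A) ->
  (forall n c r (S : 'M[R]_n), 0 < c -> posdefmx S -> P n S -> P n.+1 (schur c r S)) ->
  forall n (A : 'M[R]_n), posdefmx A -> P n A.
Proof.
move=> P0 PS; elim=> [A _|n IH A pA]; first exact: P0.
have [c [r [S [c0 pS ->]]]] := @posdefmx_schur n A pA.
by apply: PS => //; exact: IH.
Qed.

Lemma posdefmx_det_gt0 n (A : 'M[R]_n) : posdefmx A -> 0 < \det A.
Proof.
move: n A; apply: posdefmx_ind => [A|n c r S c0 _ dS]; first by rewrite det_mx00.
by rewrite (@det_schur n) ?gt_eqF// mulr_gt0.
Qed.

Lemma posdefmx_unit n (A : 'M[R]_n) : posdefmx A -> A \in unitmx.
Proof. by move=> /posdefmx_det_gt0 d0; rewrite unitmxE unitfE gt_eqF. Qed.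

Lemma posdefmx_cholesky n (A : 'M[R]_n) : posdefmx A ->
  exists M : 'M[R]_n, A = M^T *m M.
Proof.
move: n A; apply: posdefmx_ind => [A|n c r S c0 _ [M ->]].
  by exists 0; apply/matrixP => -[].
pose s := Num.sqrt c; have s0 : s != 0 by rewrite gt_eqF// sqrtr_gt0.
have ss : s * s = c by rewrite -expr2 sqr_sqrtr// ltW.
(* The first row of the triangular factor is (s, r / s); it accounts for [c], [r] and the rank-one
   term, which leaves the factor of the Schur complement. *)
suff E : schur c r (M^T *m M) = (block_mx s%:M (s^-1 *: r) 0 M)^T *m
    (block_mx s%:M (s^-1 *: r) 0 M : 'M[R]_(1 + n)).
  by exists (block_mx s%:M (s^-1 *: r) 0 M : 'M[R]_(1 + n)).
rewrite tr_block_mx mulmx_block /schur tr_scalar_mx trmx0 !mul0mx mulmx0 !addr0.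
rewrite -scalar_mxM ss mul_scalar_mx scalerA divff// scale1r; congr block_mx.
  by rewrite mul_mx_scalar linearZ /= scalerA divff// scale1r.
by rewrite -scalemxAr [(_ *: r)^T]linearZ /= -scalemxAl scalerA -invfM ss addrC.
Qed.

(** Each pivot satisfies [ln c <= c - 1], and the rank-one term in [schur] only increases the
    trace. *)
Lemma ln_det_le_trace n (A : 'M[R]_n) : posdefmx A -> ln (\det A) <= \tr A - n%:R.
Proof.
move: n A; apply: posdefmx_ind => [A|n c r S c0 pS IH].
  by rewrite det_mx00 ln1 /mxtrace big_ord0 subr0.
rewrite (@det_schur n) ?gt_eqF// lnM ?posrE ?posdefmx_det_gt0//.
rewrite (@mxtrace_block _ 1 n) mxtrace_scalar mxtraceD mxtraceZ.
have h1 : ln c <= c - 1.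
  have c1 : - 1 < c - 1 by lra.
  by have := le_ln1Dx c1; rewrite addrC subrK.
have h2 : 0 <= \tr (r^T *m r).
  by apply: sumr_ge0 => i _; rewrite mxE big_ord1 mxE -expr2 sqr_ge0.
have h3 : 0 <= c^-1 * \tr (r^T *m r) by rewrite mulr_ge0// invr_ge0 ltW.
by rewrite -natr1 mulr1n; lra.
Qed.

End schur_complement.

Section gauss_quadratic.
Context {R : realType}.
Local Notation gamma1 := (normal_prob (0 : R) 1).

Lemma colvec_tcons n x (g : n.-tuple R) :
  colvec (tcons x g) = col_mx x%:M (colvec g) :> 'cV[R]_(1 + n).
Proof.
apply/colP => i; case: (split_ordP i) => j ->.
  rewrite col_mxEu !mxE !ord1 mulr1n.
  by rewrite (_ : lshift n 0 = ord0) ?tnth0//; exact: val_inj.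
by rewrite col_mxEd !mxE (_ : rshift 1 j = lift ord0 j) ?tnthS//; exact: val_inj.
Qed.

Lemma measurable_qform d (T : measurableType d) n (A : 'M[R]_n) (f : T -> n.-tuple R) :
  measurable_fun setT f -> measurable_fun setT (fun x => qform A (colvec (f x))).
Proof.
move=> mf.
rewrite [X in measurable_fun _ X](_ : _ = fun x =>
    \sum_j (\sum_i tnth (f x) i * A i j) * tnth (f x) j); last first.
  apply/funext => x; rewrite /qform mxE; apply: eq_bigr => j _.
  by rewrite !mxE; congr *%R; apply: eq_bigr => i _; rewrite !mxE.
have mt i : measurable_fun setT (fun x => tnth (f x) i).
  exact: (measurableT_comp (measurable_tnth i)).
apply: measurable_sum => j; apply: measurable_funM => //.
by apply: measurable_sum => i; exact: measurable_funM.
Qed.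

Lemma measurable_rowmul n (r : 'rV[R]_n) :
  measurable_fun setT (fun g : n.-tuple R => (r *m colvec g) 0 0).
Proof.
rewrite [X in measurable_fun _ X](_ : _ = fun g => \sum_i r 0 i * tnth g i); last first.
  by apply/funext => g; rewrite mxE; apply: eq_bigr => i _; rewrite mxE.
by apply: measurable_sum => i; apply: measurable_funM => //; exact: measurable_tnth.
Qed.

Local Open Scope ereal_scope.
(** Tonelli puts the first coordinate innermost. Completing the square in it eliminates [r] and
    yields the factor [(Num.sqrt c)^-1]; what remains is the same integral for the Schur
    complement. *)
Lemma integral_gauss_qform n (A : 'M[R]_n) : posdefmx A ->
  \int[gauss n]_g (expR ((dotp g g - qform A (colvec g)) / 2))%:E =
  ((Num.sqrt (\det A))^-1)%:E.
Proof.
have mq n' (A' : 'M[R]_n') := measurable_qform A' (@measurable_id _ (n'.-tuple R) setT).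
move: n A; apply: posdefmx_ind => [A|n c r S c0 pS IH].
  rewrite integral_gauss0; last by have := mq _ A => /= mqA; vfun.
  by rewrite det_mx00 sqrtr1 invr1 /dotp big_ord0 /qform mxE big_ord0 subr0 mul0r expR0.
have mr := measurable_rowmul r; have mS := mq _ S; have mSS := mq _ (schur c r S).
rewrite ge0_integral_gaussS; [|vfun|by move=> g; rewrite lee_fin expR_ge0].
transitivity (\int[gamma1]_x \int[gauss n]_y ((expR ((x ^+ 2 -
    c * (x + c^-1 * (r *m colvec y) 0 0) ^+ 2) / 2))%:E *
    (expR ((dotp y y - qform S (colvec y)) / 2))%:E)).
  apply: eq_integral => x _; apply: eq_integral => y _.
  rewrite colvec_tcons dotp_cons qform_schur ?gt_eqF// -EFinM -expRD.
  by congr (expR _)%:E; lra.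
rewrite (@fubini_tonelli _ _ _ _ _ gamma1 (gauss n) (fun z => (expR ((z.1 ^+ 2 -
    c * (z.1 + c^-1 * (r *m colvec z.2) 0 0) ^+ 2) / 2))%:E *
    (expR ((dotp z.2 z.2 - qform S (colvec z.2)) / 2))%:E))/=; [|vfun|
  by move=> z; rewrite mule_ge0 ?lee_fin ?expR_ge0].
transitivity (\int[gauss n]_y (((Num.sqrt c)^-1)%:E *
    (expR ((dotp y y - qform S (colvec y)) / 2))%:E)).
  apply: eq_integral => y _; rewrite ge0_integralZr; [|by []|vfun|
    by move=> x _; rewrite lee_fin expR_ge0|by rewrite lee_fin expR_ge0].
  congr *%E; set rho := (r *m colvec y) 0%R 0%R.
  transitivity (\int[gamma1]_x ((expR (- rho ^+ 2 / (2 * c)))%:E *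
      (expR ((1 - c) * x ^+ 2 / 2 + (- rho) * x))%:E)).
    apply: eq_integral => x _; rewrite -EFinM -expRD; congr (expR _)%:E.
    by field; rewrite gt_eqF.
  rewrite ge0_integralZl; [|by []|vfun|
    by move=> x _; rewrite lee_fin expR_ge0|by rewrite lee_fin expR_ge0].
  rewrite integral_gauss1_expR// -EFinM; congr EFin.
  by rewrite mulrCA -expRD sqrrN mulNr addNr expR0 mulr1.
rewrite ge0_integralZl; [|by []|vfun|by move=> x _; rewrite lee_fin expR_ge0|
  by rewrite lee_fin invr_ge0 sqrtr_ge0].
by rewrite IH -EFinM -invfM (@det_schur _ n) ?gt_eqF// sqrtrM// ltW.
Qed.
End gauss_quadratic.

(** * Mixtures given by densities *)

Section density_kernel.
Context {d1 d2} {I : measurableType d1} {T : measurableType d2} {R : realType}.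
Variables (mu : {sigma_finite_measure set T -> \bar R}) (W : I * T -> R).
Hypotheses (mW : measurable_fun setT W) (W0 : forall z, 0 <= W z).
Hypothesis W1 : forall t, (\int[mu]_x (W (t, x))%:E = 1)%E.
Local Open Scope ereal_scope.

Let k (t : I) (A : set T) : \bar R := \int[mu]_(x in A) (W (t, x))%:E.

Let k0 t : k t set0 = 0. Proof. by rewrite /k integral_set0. Qed.

Let k_ge0 t A : 0 <= k t A.
Proof. by apply: integral_ge0 => x _; rewrite lee_fin. Qed.

Let mWt t : measurable_fun setT (fun x => W (t, x)).
Proof. exact: measurableT_comp. Qed.

Let k_sigma_additive t : semi_sigma_additive (k t).
Proof.
move=> F mF tF mUF; rewrite /k ge0_integral_bigcup//.
- by apply: is_cvg_ereal_nneg_natsum => n _; exact: k_ge0.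
- exact/measurable_EFinP/measurable_funTS.
- by move=> x _; rewrite lee_fin.
Qed.

HB.instance Definition _ t := isMeasure.Build _ _ _ (k t)
  (k0 t) (k_ge0 t) (@k_sigma_additive t).

Let kk (t : I) : {measure set T -> \bar R} := k t.

Let measurable_kk A : measurable A -> measurable_fun setT (kk ^~ A).
Proof.
move=> mA; rewrite /kk /= /k.
under eq_fun do rewrite integral_mkcond/=.
pose f (z : I * T) := (W z * \1_A z.2)%:E.
have -> : (fun t => \int[mu]_x ((fun x => (W (t, x))%:E) \_ A) x) =
    (fun t => \int[mu]_x f (t, x)).
  apply/funext => t; apply: eq_integral => x _.
  by rewrite /f patchE indicE /=; case: ifP => _; rewrite ?mulr1 ?mulr0.
apply: measurable_fun_fubini_tonelli_F.
- apply/measurable_EFinP; apply: measurable_funM => //.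
  by apply: measurableT_comp => //; exact: measurable_indic.
- by move=> z; rewrite lee_fin mulr_ge0.
Qed.

HB.instance Definition _ := isKernel.Build _ _ _ _ _ kk measurable_kk.

Let kk1 t : kk t setT = 1. Proof. exact: W1. Qed.

HB.instance Definition _ := Kernel_isProbability.Build _ _ _ _ _ kk kk1.

Lemma ex_density_kernel :
  exists mu_ : R.-pker I ~> T, forall t, is_density mu (mu_ t) (fun x => W (t, x)).
Proof. by exists kk => t; split. Qed.

End density_kernel.

Section measure_probability.
Context {d} {T : measurableType d} {R : realType}.
Variable mu : {measure set T -> \bar R}.
Hypothesis mu1 : mu setT = 1%E.

Let P : set T -> \bar R := mu.
HB.instance Definition _ := Measure.on P.
HB.instance Definition _ := Measure_isProbability.Build _ _ _ P mu1.

Lemma measure_probability : exists P : probability T R, forall A, P A = mu A.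
Proof. by exists P. Qed.

End measure_probability.

(** A single probability with a given density is the value of a density kernel over the one-point
    index space. *)
Lemma ex_density_probability {d} {T : measurableType d} {R : realType}
    (nu : {sigma_finite_measure set T -> \bar R}) (w : T -> R) :
  measurable_fun setT w -> (forall x, 0 <= w x) ->
  (\int[nu]_x (w x)%:E = 1)%E ->
  exists P : probability T R, is_density nu P w.
Proof.
move=> mw w0 w1.
have [|//|//|k kE] := @ex_density_kernel _ _ unit T R nu (fun z => w z.2).
  exact: measurableT_comp.
have kT : k tt setT = 1%E by rewrite (@prob_kernel _ _ _ _ _ k).
have [P PE] := measure_probability kT.
by exists P; split=> // A mA; rewrite PE; case: (kE tt) => _ _; exact.
Qed.

Section mixture.
Context {d1 d2} {I : measurableType d1} {T : measurableType d2} {R : realType}.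
Variables (m : probability I R) (mu : probability T R) (mu_ : R.-pker I ~> T).
Variable W : I * T -> R.
Hypotheses (mW : measurable_fun setT W) (W0 : forall z, 0 <= W z).
Hypothesis dmu : forall t, is_density mu (mu_ t) (fun x => W (t, x)).
Hypothesis Wm1 : forall x, (\int[m]_t (W (t, x))%:E = 1)%E.
Hypothesis Wbounded : forall t, exists B, forall x, W (t, x) <= B.
Local Open Scope ereal_scope.

Lemma measurable_integral_mixture (F : I * T -> \bar R) :
  measurable_fun setT F -> (forall z, 0 <= F z) ->
  measurable_fun setT (fun t => \int[mu_ t]_x F (t, x)).
Proof.
move=> mF F0.
have -> : (fun t => \int[mu_ t]_x F (t, x)) =
    (fun t => \int[mu]_x (F (t, x) * (W (t, x))%:E)).
  apply/funext => t; rewrite (ge0_integral_density (dmu t))//.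
  exact: measurableT_comp.
apply: (@measurable_fun_fubini_tonelli_F _ _ _ _ _ mu (fun z => F z * (W z)%:E)).
- by mfun.
- by move=> z; rewrite mule_ge0// lee_fin.
Qed.

(** The law of total expectation: by Tonelli the weight of each [x] is the mean over [m] of its
    density, which is 1 by [Wm1]. *)
Lemma ge0_integral_mixture (F : T -> \bar R) :
  measurable_fun setT F -> (forall x, 0 <= F x) ->
  \int[m]_t \int[mu_ t]_x F x = \int[mu]_x F x.
Proof.
move=> mF F0.
under eq_integral do rewrite (ge0_integral_density (dmu _))//.
rewrite (@fubini_tonelli _ _ _ _ _ m mu (fun z => F z.2 * (W z)%:E))/=; last 2 first.
- apply: emeasurable_funM; first exact: measurableT_comp.
  exact/measurable_EFinP.
- by move=> z; rewrite mule_ge0// lee_fin.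
apply: eq_integral => x _; rewrite ge0_integralZl//.
- by rewrite Wm1 mule1.
- by apply/measurable_EFinP; exact: measurableT_comp.
- by move=> t _; rewrite lee_fin.
Qed.

Lemma mixture_measure (A : set T) : measurable A -> mu A = \int[m]_t mu_ t A.
Proof.
move=> mA.
transitivity (\int[m]_t \int[mu_ t]_x (\1_A x)%:E).
  rewrite ge0_integral_mixture//; last exact/measurable_EFinP/measurable_indic.
  by rewrite integral_indic// setIT.
by apply: eq_integral => t _; rewrite integral_indic// setIT.
Qed.

Section integrable.
Variable f : T -> R.
Hypothesis fi : mu.-integrable setT (fun x => (f x)%:E).

Let mf : measurable_fun setT f. Proof. exact: (rintegrable_measurable fi). Qed.

(** Boundedness of the density in [x] is what gives this for every [t]; Tonelli alone would give it
    for [m]-almost every [t]. *)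
Lemma mixture_integrable t : (mu_ t).-integrable setT (fun x => (f x)%:E).
Proof.
apply/(integrable_densityP (dmu t)); first exact/measurable_EFinP.
have [B WB] := Wbounded t.
have mWt : measurable_fun setT (fun x => W (t, x)) by exact: measurableT_comp.
apply: (@le_rintegrable _ _ _ mu (fun x => f x * W (t, x))%R (fun x => B * `|f x|)%R).
- exact: measurable_funM.
- by move=> x; rewrite normrM (ger0_norm (W0 _)) mulrC ler_wpM2r.
- by apply: rintegrableZl; exact: integrable_norm.
Qed.

Let pos : I -> \bar R := fun t => \int[mu_ t]_x (EFin \o f)^\+ x.
Let neg : I -> \bar R := fun t => \int[mu_ t]_x (EFin \o f)^\- x.

Let mfE : measurable_fun setT (EFin \o f). Proof. exact/measurable_EFinP. Qed.

Let measurable_pos : measurable_fun setT pos.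
Proof.
apply: (measurable_integral_mixture (F := fun z => (EFin \o f)^\+ z.2)) => //.
by apply: measurableT_comp => //; exact: measurable_funepos.
Qed.

Let measurable_neg : measurable_fun setT neg.
Proof.
apply: (measurable_integral_mixture (F := fun z => (EFin \o f)^\- z.2)) => //.
by apply: measurableT_comp => //; exact: measurable_funeneg.
Qed.

Let integrable_pos : m.-integrable setT pos.
Proof.
apply/integrableP; split => //.
under eq_integral do rewrite gee0_abs ?integral_ge0//.
rewrite ge0_integral_mixture//; last exact: measurable_funepos.
exact: integral_funepos_lt_pinfty.
Qed.

Let integrable_neg : m.-integrable setT neg.
Proof.
apply/integrableP; split => //.
under eq_integral do rewrite gee0_abs ?integral_ge0//.
rewrite ge0_integral_mixture//; last exact: measurable_funeneg.
exact: integral_funeneg_lt_pinfty.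
Qed.

Let posnegE t : (\int[mu_ t]_x f x)%:E = pos t - neg t.
Proof. by rewrite EFin_Rintegral; [rewrite integralE|exact: mixture_integrable]. Qed.

Lemma mixture_Rintegral_integrable :
  m.-integrable setT (fun t => (\int[mu_ t]_x f x)%:E).
Proof.
by under eq_fun do rewrite posnegE; exact: integrableB.
Qed.

Lemma mixture_Rintegral :
  (\int[m]_t \int[mu_ t]_x f x = \int[mu]_x f x)%R.
Proof.
apply: EFin_inj; rewrite !EFin_Rintegral//; last exact: mixture_Rintegral_integrable.
under eq_integral do rewrite posnegE.
rewrite integralB// /pos /neg !ge0_integral_mixture//.
- by rewrite [RHS]integralE.
- exact: measurable_funeneg.
- exact: measurable_funepos.
Qed.

End integrable.

End mixture.

(** * Entropy computed from any density, and its chain rule *)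

Section entropy_density.
Context {d} {T : measurableType d} {R : realType}.
Variable nu : {measure set T -> \bar R}.
Local Open Scope ereal_scope.

Lemma density_is_density (mu : {measure set T -> \bar R}) f :
  is_density nu mu f -> is_density nu mu (density nu mu).
Proof. by move=> df; exact: (xgetPex _ (ex_intro _ f df)). Qed.

Lemma is_density_unique (mu : {measure set T -> \bar R}) (f g : T -> R) :
  mu setT < +oo -> is_density nu mu f -> is_density nu mu g ->
  ae_eq nu setT (EFin \o f) (EFin \o g).
Proof.
move=> muT [mf f0 fE] [mg g0 gE]; apply: integral_ae_eq => //.
- by apply: ge0_rintegrable => //; rewrite -fE.
- exact/measurable_EFinP.
- by move=> E _ mE; rewrite -fE// -gE.
Qed.

Variables (mu : {measure set T -> \bar R}) (f : T -> R).
Hypothesis muT : mu setT < +oo.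
Hypothesis df : is_density nu mu f.

Let h := density nu mu.
Let dh : is_density nu mu h. Proof. exact: density_is_density df. Qed.

Let mlnh : measurable_fun setT (fun x => (ln (h x))%:E).
Proof.
apply/measurable_EFinP; apply: (measurableT_comp (@measurable_ln R)).
by case: dh.
Qed.

Let mlnf : measurable_fun setT (fun x => (ln (f x))%:E).
Proof.
apply/measurable_EFinP; apply: (measurableT_comp (@measurable_ln R)).
by case: df.
Qed.

Let ae_ln : ae_eq nu setT (fun x => (ln (h x))%:E * (h x)%:E)
  (fun x => (ln (f x))%:E * (f x)%:E).
Proof.
by have := is_density_unique muT dh df; apply: filterS => x + _ => /(_ I) [->].
Qed.

Let mlnhh : measurable_fun setT (fun x => (ln (h x))%:E * (h x)%:E).
Proof. by apply: emeasurable_funM => //; apply/measurable_EFinP; case: dh. Qed.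

Let mlnff : measurable_fun setT (fun x => (ln (f x))%:E * (f x)%:E).
Proof. by apply: emeasurable_funM => //; apply/measurable_EFinP; case: df. Qed.

(** Integrals against [mu] are rewritten over [nu] with the density as a factor; the two densities
    agree [nu]-almost everywhere, so the choice made by [density] is immaterial. *)
Lemma integrable_ln_density :
  mu.-integrable setT (fun x => (ln (density nu mu x))%:E) <->
  mu.-integrable setT (fun x => (ln (f x))%:E).
Proof.
rewrite (integrable_densityP dh mlnh) (integrable_densityP df mlnf).
split=> /integrableP[_ i]; apply/integrableP; split => //; apply: le_lt_trans i;
  rewrite le_eqVlt; apply/orP; left; apply/eqP; apply: ae_eq_integral => //;
  try exact: measurableT_comp.
- by apply: filterS ae_ln => x /[apply] ->.
- by apply: filterS ae_ln => x /[apply] ->.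
Qed.

Lemma entropy_density : entropy nu mu = (- \int[mu]_x ln (f x))%R.
Proof.
rewrite /entropy /Rintegral (integral_density dh mlnh) (integral_density df mlnf).
by congr (- fine _)%R; exact: ae_eq_integral.
Qed.

End entropy_density.

Section tilted_entropy.
Context {d} {T : measurableType d} {R : realType}.
Variables (nu mu mu' : {measure set T -> \bar R}).
Hypothesis mu'T : (mu' setT < +oo)%E.
Variables (rho w : T -> R).
Hypotheses (drho : is_density nu mu rho) (dw : is_density mu mu' w).
Hypothesis w_gt0 : forall x, 0 < w x.
Hypothesis ilnrho : mu'.-integrable setT (fun x => (ln (rho x))%:E).
Hypothesis ilnw : mu'.-integrable setT (fun x => (ln (w x))%:E).

Let mrho : measurable_fun setT rho. Proof. by case: drho. Qed.
Let rho0 x : 0 <= rho x. Proof. by case: drho. Qed.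
Let mw : measurable_fun setT w. Proof. by case: dw. Qed.

Lemma is_density_trans : is_density nu mu' (fun x => w x * rho x).
Proof.
split=> [|x|A mA]; [exact: measurable_funM|by rewrite mulr_ge0// ltW|].
have [_ _ ->//] := dw.
rewrite integral_mkcond (ge0_integral_density drho)//=; last 2 first.
- apply/(measurable_restrictT _ _).1 => //; apply: measurable_funTS.
  exact/measurable_EFinP.
- by move=> x; rewrite patchE; case: ifP => //; rewrite lee_fin ltW.
rewrite [RHS]integral_mkcond; apply: eq_integral => x _.
by rewrite !patchE; case: ifP => _; rewrite ?mul0e ?EFinM.
Qed.

Let mlnM : measurable_fun setT (fun x => (ln (w x * rho x))%:E).
Proof.
apply/measurable_EFinP; apply: (measurableT_comp (@measurable_ln R)).
exact: measurable_funM.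
Qed.

Let mlnD : measurable_fun setT (fun x => (ln (w x) + ln (rho x))%:E).
Proof.
apply/measurable_EFinP; apply: measurable_funD.
- exact: (measurableT_comp (@measurable_ln R)).
- exact: (measurableT_comp (@measurable_ln R)).
Qed.

(** Where [rho] vanishes, [ln] takes its default value 0 and the product rule fails; the density as
    a factor removes these points. *)
Let lnM_lnD x : ((ln (w x * rho x))%:E * (w x * rho x)%:E =
  (ln (w x) + ln (rho x))%:E * (w x * rho x)%:E)%E.
Proof.
have := rho0 x; rewrite le_eqVlt => /predU1P[<-|rx].
  by rewrite !mulr0 !mule0.
by rewrite lnM ?posrE.
Qed.

Let ilnD : mu'.-integrable setT (fun x => (ln (w x) + ln (rho x))%:E).
Proof. exact: rintegrableD. Qed.

Lemma tilted_entropy_exists : entropy_exists nu mu'.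
Proof.
split; first by eexists; exact: is_density_trans.
apply/(integrable_ln_density mu'T is_density_trans).
apply/(integrable_densityP is_density_trans mlnM).
have /(integrable_densityP is_density_trans mlnD) := ilnD.
by apply: eq_integrable => // x _; rewrite lnM_lnD.
Qed.

(** The chain rule. For posteriors, the first integral is the relative entropy to [mu], and the
    second averages back to its value under [mu]. *)
Lemma tilted_entropy :
  entropy nu mu' = - (\int[mu']_x ln (w x)) - (\int[mu']_x ln (rho x)).
Proof.
rewrite (entropy_density mu'T is_density_trans) -opprD -RintegralD//.
congr (- _); congr fine.
rewrite (integral_density is_density_trans mlnM) (integral_density is_density_trans mlnD).
exact: eq_integral.
Qed.

End tilted_entropy.

(** * Covariance matrices *)

Section mxintegral_linear.
Context {d} {T : measurableType d} {R : realType}.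
Variable mu : {measure set T -> \bar R}.

Lemma qformE n (A : 'M[R]_n) v :
  qform A v = \sum_j \sum_i v i 0 * v j 0 * A i j.
Proof.
rewrite /qform mxE; apply: eq_bigr => j _; rewrite mxE big_distrl /=.
by apply: eq_bigr => i _; rewrite mxE; ring.
Qed.

Lemma qform_integrable n (F : T -> 'M[R]_n) v : mxintegrable mu F ->
  mu.-integrable setT (fun x => (qform (F x) v)%:E).
Proof.
move=> Fi; under eq_fun do rewrite qformE.
apply: rintegrable_sum => j; apply: rintegrable_sum => i.
exact: rintegrableZl.
Qed.

Lemma Rintegral_qform n (F : T -> 'M[R]_n) v : mxintegrable mu F ->
  \int[mu]_x qform (F x) v = qform (mxintegral mu F) v.
Proof.
move=> Fi; under eq_Rintegral do rewrite qformE.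
have Fij i j : mu.-integrable setT (fun x => (v i 0 * v j 0 * F x i j)%:E).
  exact: rintegrableZl.
rewrite qformE Rintegral_sum; last by move=> j; exact: rintegrable_sum.
apply: eq_bigr => j _; rewrite Rintegral_sum//; apply: eq_bigr => i _.
by rewrite [mxintegral _ _ _ _]mxE (RintegralZl _ measurableT (Fi i j)).
Qed.

Lemma rowmul_integrable n (F : T -> 'cV[R]_n) (r : 'rV[R]_n) : mxintegrable mu F ->
  mu.-integrable setT (fun x => ((r *m F x) 0 0)%:E).
Proof.
move=> Fi; under eq_fun do rewrite mxE.
by apply: rintegrable_sum => i; exact: rintegrableZl.
Qed.

Lemma Rintegral_rowmul n (F : T -> 'cV[R]_n) (r : 'rV[R]_n) : mxintegrable mu F ->
  \int[mu]_x (r *m F x) 0 0 = (r *m mxintegral mu F) 0 0.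
Proof.
move=> Fi; under eq_Rintegral do rewrite mxE.
rewrite Rintegral_sum; last by move=> i; exact: rintegrableZl.
by rewrite mxE; apply: eq_bigr => i _;
  rewrite [mxintegral _ _ _ _]mxE (RintegralZl _ measurableT (Fi i 0)).
Qed.

End mxintegral_linear.

Section covariance.
Context {R : realType} {n : nat}.
Variable P : {measure set (n.-tuple R) -> \bar R}.
Hypotheses (P1 : P setT = 1%E) (covP : cov_exists P).

Definition meanvec := mxintegral P (@colvec R n).

Lemma qform_outer_square p (u v : 'cV[R]_p) :
  qform (outer_square u) v = ((v^T *m u) 0 0) ^+ 2.
Proof.
rewrite /qform /outer_square mulmxA -mulmxA mxE big_ord1 expr2.
by congr *%R; rewrite -[u^T *m v]trmxK trmx_mul trmxK mxE.
Qed.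

Let sqE (v : 'cV[R]_n) b (x : n.-tuple R) : ((v^T *m colvec x) 0 0 - b) ^+ 2 =
  qform (outer_square (colvec x)) v - 2 * b * (v^T *m colvec x) 0 0 + b ^+ 2 :> R.
Proof. by rewrite qform_outer_square; ring. Qed.

Lemma sqdev_integrable (v : 'cV[R]_n) b :
  P.-integrable setT (fun x => (((v^T *m colvec x) 0 0 - b) ^+ 2)%:E).
Proof.
have [i1 i2] := covP; under eq_fun do rewrite sqE.
apply: rintegrableD; last exact: rintegrable_cst_mass1.
apply: rintegrableB; first exact: qform_integrable.
by apply: rintegrableZl; exact: rowmul_integrable.
Qed.

(** The decomposition into variance and squared bias: the covariance is a lower bound for the mean
    square error of every constant [b], with equality at the mean. *)
Lemma Rintegral_sqdev (v : 'cV[R]_n) b :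
  \int[P]_x ((v^T *m colvec x) 0 0 - b) ^+ 2 =
  qform (covmx P) v + ((v^T *m meanvec) 0 0 - b) ^+ 2.
Proof.
have [i1 i2] := covP; under eq_Rintegral do rewrite sqE.
have j1 := qform_integrable v i2.
have j2 := rintegrableZl (2 * b) (rowmul_integrable v^T i1).
rewrite RintegralD//; last 2 first.
- exact: rintegrableB.
- exact: rintegrable_cst_mass1.
rewrite RintegralB// (Rintegral_cst_mass1 P1) RintegralZl//; last exact: rowmul_integrable.
rewrite Rintegral_qform// Rintegral_rowmul//.
rewrite /covmx -/meanvec qformB qform_outer_square.
ring.
Qed.

Lemma covmx_psd : possemidefmx (covmx P).
Proof.
split=> [|v].
  rewrite /covmx linearB /= /outer_square trmx_mul trmxK; congr (_ - _).
  by apply/matrixP => i j; rewrite !mxE; apply: eq_Rintegral => x _; rewrite !mxE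
    !big_ord1 !mxE mulrC.
rewrite -/(qform _ v).
have := Rintegral_sqdev v ((v^T *m meanvec) 0 0).
rewrite subrr expr0n addr0 => <-; apply: Rintegral_ge0 => x _; exact: sqr_ge0.
Qed.

End covariance.

Section psd_matrices.
Context {R : realType} {n : nat}.
Implicit Types (A : 'M[R]_n) (v y : 'cV[R]_n).

Definition tvec v : n.-tuple R := [tuple v i 0 | i < n].

Lemma tvecK v : colvec (tvec v) = v.
Proof. by apply/colP => i; rewrite mxE tnth_mktuple. Qed.

Lemma dotpE (g h : n.-tuple R) : dotp g h = ((colvec g)^T *m colvec h) 0 0.
Proof. by rewrite mxE; apply: eq_bigr => i _; rewrite !mxE. Qed.

(** Nonnegativity of the form at [y_j e_i - y_i e_j] bounds each cross term by diagonal ones;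
    summing over all pairs produces the trace, without eigenvalues. *)
Lemma psd_qform_le_trace A y : possemidefmx A ->
  qform A y <= \tr A * dotp (tvec y) (tvec y).
Proof.
move=> [As Ap].
have H i j : 2 * (y i 0 * y j 0 * A i j) <= y j 0 ^+ 2 * A i i + y i 0 ^+ 2 * A j j.
  have [->|ij] := eqVneq i j; first by lra.
  have := Ap (y j 0 *: delta_mx i 0 - y i 0 *: delta_mx j 0).
  rewrite [(_ - _)^T]linearB /= ![(_ *: _)^T]linearZ /= !mulmxBl !mulmxBr.
  rewrite -!scalemxAl -!scalemxAr !trmx_delta.
  have D k l : delta_mx 0 k *m A *m delta_mx l 0 = (A k l)%:M :> 'M[R]_1.
    by rewrite [LHS]mx11_scalar -rowE -colE !mxE.
  rewrite !D !mxE eqxx !mulr1n.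
  have -> : A j i = A i j by rewrite -{1}As mxE.
  lra.
have -> : qform A y = 2^-1 * \sum_j \sum_i 2 * (y i 0 * y j 0 * A i j).
  rewrite qformE mulr_sumr; apply: eq_bigr => j _.
  by rewrite mulr_sumr; apply: eq_bigr => i _; rewrite mulKf.
have -> : \tr A * dotp (tvec y) (tvec y) =
    2^-1 * \sum_j \sum_i (y j 0 ^+ 2 * A i i + y i 0 ^+ 2 * A j j).
  under [in RHS]eq_bigr do rewrite big_split /= -mulr_sumr -mulr_suml.
  rewrite big_split /= -mulr_suml -mulr_sumr -/(\tr A).
  have -> : dotp (tvec y) (tvec y) = \sum_i y i 0 ^+ 2.
    by apply: eq_bigr => i _; rewrite !tnth_mktuple expr2.
  by field.
by rewrite ler_pM2l// ler_sum// => j _; apply: ler_sum => i _; exact: H.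
Qed.

Lemma possemidefmx_conj A (M : 'M[R]_n) : possemidefmx A -> possemidefmx (M *m A *m M^T).
Proof.
move=> [As Ap]; split; first by rewrite !trmx_mul trmxK As mulmxA.
move=> v; have := Ap (M^T *m v).
by rewrite trmx_mul trmxK !mulmxA.
Qed.

Lemma qform_conj A (M : 'M[R]_n) v : qform (M *m A *m M^T) v = qform A (M^T *m v).
Proof. by rewrite /qform trmx_mul trmxK !mulmxA. Qed.

Lemma psd_trace_ge0 A : possemidefmx A -> 0 <= \tr A.
Proof.
move=> [As Ap]; apply: sumr_ge0 => i _.
have := Ap (delta_mx i 0); rewrite trmx_delta.
by rewrite -rowE -colE !mxE.
Qed.

Lemma qform_sandwich A (M : 'M[R]_n) v : A^T = A ->
  qform (A *m (M^T *m M) *m A) v = dotp (tvec (M *m A *m v)) (tvec (M *m A *m v)).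
Proof. by move=> As; rewrite /qform dotpE tvecK !trmx_mul As !mulmxA. Qed.

(** Here [A] is the covariance before an extra observation [e Y + z], and the first two summands are
    the error of the linear estimator with coefficients [c]. The optimal [c] involves the inverse of
    [1 + e^2 M A M^T]; replacing this matrix by the scalar [1 + e ^+ 2 * r] loses nothing in the
    limit of small [e]. *)
Lemma qform_variance_gain A (M : 'M[R]_n) v (e : R) : possemidefmx A -> 0 <= e ->
  let r := \tr (M *m A *m M^T) in
  let q := qform (A *m (M^T *m M) *m A) v in
  let c := (e / (1 + e ^+ 2 * r)) *: (M *m A *m v) in
  qform A (v - e *: (M^T *m c)) + dotp (tvec c) (tvec c) + e ^+ 2 * (q / (1 + e ^+ 2 * r))
    <= qform A v.
Proof.
move=> pA e0; cbv zeta; set r := \tr _; set q := qform (_ *m _ *m _) v; set c := _ *: (M *m A *m v).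
have [As Ap] := pA.
pose y := M *m A *m v.
have r0 : 0 <= r by exact/psd_trace_ge0/possemidefmx_conj.
have d0 : 0 < 1 + e ^+ 2 * r by rewrite ltr_pwDl// mulr_ge0// sqr_ge0.
have qE : q = dotp (tvec y) (tvec y).
  exact: qform_sandwich.
pose be := e / (1 + e ^+ 2 * r).
have cc : dotp (tvec c) (tvec c) = be ^+ 2 * q.
  have -> : c = be *: y by [].
  by rewrite qE !dotpE !tvecK [(be *: y)^T]linearZ /= -scalemxAr -scalemxAl scalerA mxE -expr2.
have wE : e *: (M^T *m c) = (e * be) *: (M^T *m y).
  by rewrite -scalemxAr scalerA.
have crossE : ((M^T *m y)^T *m A *m v) 0 0 = q.
  by rewrite qE dotpE !tvecK trmx_mul trmxK /y -!mulmxA.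
have qD (w : 'cV[R]_n) : qform A (v - w) = qform A v - 2 * (w^T *m A *m v) 0 0 + qform A w.
  rewrite /qform [(_ - _)^T]linearB /= !mulmxBl !mulmxBr.
  have -> : v^T *m A *m w = (w^T *m A *m v)^T by rewrite !trmx_mul trmxK As mulmxA.
  by rewrite !mxE; ring.
have qw : qform A (M^T *m y) <= r * q.
  by rewrite -qform_conj qE; exact/psd_qform_le_trace/possemidefmx_conj.
rewrite wE cc qD.
have -> : qform A ((e * be) *: (M^T *m y)) = (e * be) ^+ 2 * qform A (M^T *m y).
  by rewrite /qform [(_ *: _)^T]linearZ /= -!scalemxAl -!scalemxAr scalerA mxE -expr2.
have -> : (((e * be) *: (M^T *m y))^T *m A *m v) 0 0 = e * be * q.
  by rewrite [(_ *: _)^T]linearZ /= -!scalemxAl mxE crossE.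
have h1 : (e * be) ^+ 2 * qform A (M^T *m y) <= (e * be) ^+ 2 * (r * q).
  by rewrite ler_wpM2l// sqr_ge0.
have h2 : (e * be) ^+ 2 * (r * q) + be ^+ 2 * q = e * be * q.
  by rewrite /be; field; rewrite gt_eqF.
have h3 : e ^+ 2 * (q / (1 + e ^+ 2 * r)) = e * be * q.
  by rewrite /be; field; rewrite gt_eqF.
rewrite h3; lra.
Qed.

End psd_matrices.

(** * The Gaussian channel *)

Section gaussian_kernel.
Context {R : realType} {n : nat}.
Implicit Types (g h y : n.-tuple R) (s : R).

(* The density at [g] of N(s y, Id) with respect to N(0, Id). *)
Definition gausslik s g y : R := expR (s * dotp g y - s ^+ 2 / 2 * dotp y y).

Lemma gausslik_gt0 s g y : 0 < gausslik s g y. Proof. exact: expR_gt0. Qed.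

(** Expand [|g - s y|^2 >= 0]. The bound is uniform in [y], hence posterior densities are
    bounded. *)
Lemma gausslik_le s g y : gausslik s g y <= expR (dotp g g / 2).
Proof.
rewrite ler_expR; have := dotp_ge0 (combt 1 g (- s) y).
rewrite !dotp_combl !dotp_combr (dotpC y g); lra.
Qed.

(** Sufficiency: for two independent observations, the joint likelihood depends on [y] only through
    one observation of combined strength [u]. *)
Lemma gausslik_rotation s e u g h y : u != 0 -> s ^+ 2 + e ^+ 2 = u ^+ 2 ->
  gausslik u (combt (s / u) g (e / u) h) y = gausslik s g y * gausslik e h y.
Proof.
move=> u0 su; rewrite /gausslik -expRD dotp_combl -su; congr expR; field.
by [].
Qed.

Lemma measurable_gausslik d (T : measurableType d) (f : T -> R) (g y : T -> n.-tuple R) :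
  measurable_fun setT f -> measurable_fun setT g -> measurable_fun setT y ->
  measurable_fun setT (fun x => gausslik (f x) (g x) (y x)).
Proof. move=> mf mg my; rewrite /gausslik; vfun. Qed.

(** This is the shift formula at [c = s y]; it replaces the reference law of the observation by its
    law given [y]. *)
Lemma integral_gausslik s y (F : n.-tuple R -> \bar R) :
  measurable_fun setT F -> (forall g, 0 <= F g)%E ->
  (\int[gauss n]_g ((gausslik s g y)%:E * F g) = \int[gauss n]_z F (combt 1 z s y))%E.
Proof.
move=> mF F0; pose c := combt s y 0 y.
transitivity (\int[gauss n]_g ((expR (dotp c g - dotp c c / 2))%:E * F g))%E.
  apply: eq_integral => g _; congr ((expR _)%:E * _)%E.
  by rewrite /c !dotp_combl !dotp_combr (dotpC y g); field.
rewrite integral_gauss_shift//; apply: eq_integral => z _; congr F.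
by apply: eq_from_tnth => i; rewrite !tnth_mktuple; ring.
Qed.

End gaussian_kernel.

Section channel.
Context {d} {T : measurableType d} {R : realType} {n : nat}.
Local Notation I := (measurableTypeR R * n.-tuple R)%type.
Variables (mu : probability T R) (Y : T -> n.-tuple R).
Hypothesis mY : measurable_fun setT Y.
Hypothesis iY : forall c, mu.-integrable setT (fun x => (dotp c (Y x))%:E).
Hypothesis iYY : mu.-integrable setT (fun x => (dotp (Y x) (Y x))%:E).

Let mu1 : mu setT = 1%E. Proof. exact: probability_setT. Qed.

Lemma measurable_sqrt : measurable_fun setT (@Num.sqrt R).
Proof. by apply: continuous_measurable_fun; exact: sqrt_continuous. Qed.

(* The parameter is a pair of a time [t], uniform on [1, 2], and an observation
   [g = z + sqrt t Y(x)], with [z] standard Gaussian and [x] of law [mu]. Densities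
   on parameters are relative to [refprob], the law obtained for [Y = 0]. *)
Definition timelaw : probability (measurableTypeR R) R := uniform_prob (ltr1n R 2).

Definition refprob : probability I R := (timelaw \x gauss n)%E.

Definition obslik (z : I * T) : R := gausslik (Num.sqrt z.1.1) z.1.2 (Y z.2).

Definition obsmarg (t : I) : R := \int[mu]_x obslik (t, x).

Definition postden (z : I * T) : R := obslik z / obsmarg z.1.

Lemma measurable_obslik : measurable_fun setT obslik.
Proof.
have msqrt := measurable_sqrt.
apply: measurable_gausslik.
- apply: (measurableT_comp msqrt).
  exact: (measurableT_comp measurable_fst measurable_fst).
- exact: (measurableT_comp measurable_snd measurable_fst).
- exact: (measurableT_comp mY measurable_snd).
Qed.

Lemma obslik_gt0 z : 0 < obslik z. Proof. exact: gausslik_gt0. Qed.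

Let mlik1 t : measurable_fun setT (fun x => obslik (t, x)).
Proof. by apply: (measurableT_comp measurable_obslik). Qed.

Lemma obslik_integrable t : mu.-integrable setT (fun x => (obslik (t, x))%:E).
Proof.
apply: (@le_rintegrable _ _ _ mu _ (fun=> expR (dotp t.2 t.2 / 2))) => //.
- by move=> x; rewrite ger0_norm ?gausslik_le// ltW// obslik_gt0.
- exact: (rintegrable_cst mu).
Qed.

Lemma obsmargE t : (obsmarg t)%:E = (\int[mu]_x (obslik (t, x))%:E)%E.
Proof. by rewrite EFin_Rintegral//; exact: obslik_integrable. Qed.

Definition meanlnlik (t : I) : R :=
  \int[mu]_x (Num.sqrt t.1 * dotp t.2 (Y x) - Num.sqrt t.1 ^+ 2 / 2 * dotp (Y x) (Y x)).

Lemma lnlik_integrable t : mu.-integrable setT (fun x =>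
  (Num.sqrt t.1 * dotp t.2 (Y x) - Num.sqrt t.1 ^+ 2 / 2 * dotp (Y x) (Y x))%:E).
Proof. by apply: rintegrableB; exact: rintegrableZl. Qed.

(* Jensen's inequality for expR, from the tangent line at the mean. *)
Lemma obsmarg_ge t : expR (meanlnlik t) <= obsmarg t.
Proof.
set b := meanlnlik t.
have tangent (e : R) : expR b * (1 + (e - b)) <= expR e.
  by rewrite -{2}(subrKC b e) expRD ler_wpM2l ?expR_ge0 ?expR_ge1Dx.
have i1 := lnlik_integrable t.
have i0 k : mu.-integrable setT (fun=> k%:E) := rintegrable_cst mu k.
have -> : expR b = \int[mu]_x (expR b * (1 + (Num.sqrt t.1 * dotp t.2 (Y x) -
    Num.sqrt t.1 ^+ 2 / 2 * dotp (Y x) (Y x) - b))).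
  rewrite RintegralZl//; last by apply: rintegrableD => //; exact: rintegrableB.
  rewrite (RintegralD measurableT (i0 1) (rintegrableB i1 (i0 b))).
  rewrite (RintegralB measurableT i1 (i0 b)) !(Rintegral_cst_mass1 mu1) -/(meanlnlik t) -/b.
  by rewrite subrr addr0 mulr1.
apply: le_Rintegral => //.
- by apply: rintegrableZl; apply: rintegrableD => //; exact: rintegrableB.
- exact: obslik_integrable.
Qed.

Lemma obsmarg_gt0 t : 0 < obsmarg t.
Proof. exact: lt_le_trans (expR_gt0 _) (obsmarg_ge t). Qed.

Lemma measurable_obsmarg : measurable_fun setT obsmarg.
Proof.
rewrite /obsmarg /Rintegral.
apply: (measurableT_comp (fine_measurable measurableT)).
apply: (@measurable_fun_fubini_tonelli_F _ _ _ _ _ mu (fun z => (obslik z)%:E)).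
- by apply/measurable_EFinP; exact: measurable_obslik.
- by move=> z; rewrite lee_fin ltW// obslik_gt0.
Qed.

Lemma measurable_postden : measurable_fun setT postden.
Proof.
rewrite /postden; apply: measurable_funM; first exact: measurable_obslik.
(* As [obsmarg] is positive, its inverse can be written through [ln] and [expR], whose measurability
   is available. The same device recurs below. *)
have -> : (fun z : I * T => (obsmarg z.1)^-1) = (fun z => expR (- ln (obsmarg z.1))).
  by apply/funext => z; rewrite expRN lnK// posrE obsmarg_gt0.
apply: (measurableT_comp (@measurable_expR R)); apply: measurable_funN.
apply: (measurableT_comp (@measurable_ln R)).
exact: (measurableT_comp measurable_obsmarg measurable_fst).
Qed.

Lemma postden_gt0 z : 0 < postden z.
Proof. by rewrite divr_gt0 ?obslik_gt0 ?obsmarg_gt0. Qed.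

Lemma postden_ge0 z : 0 <= postden z. Proof. by rewrite ltW// postden_gt0. Qed.

Lemma postden_bounded t : exists B, forall x, postden (t, x) <= B.
Proof.
exists (expR (dotp t.2 t.2 / 2) / obsmarg t) => x.
by rewrite ler_pM2r ?invr_gt0 ?obsmarg_gt0// gausslik_le.
Qed.

Lemma postdenM t x : postden (t, x) * obsmarg t = obslik (t, x).
Proof. by rewrite divfK// gt_eqF// obsmarg_gt0. Qed.

Local Open Scope ereal_scope.

Lemma integral_postden t : \int[mu]_x (postden (t, x))%:E = 1.
Proof.
under eq_integral do rewrite /postden /= mulrC EFinM.
rewrite ge0_integralZl//; last 3 first.
- exact/measurable_EFinP.
- by move=> x _; rewrite lee_fin ltW// obslik_gt0.
- by rewrite lee_fin invr_ge0 ltW// obsmarg_gt0.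
by rewrite -obsmargE -EFinM mulVf// gt_eqF// obsmarg_gt0.
Qed.

Lemma integral_refprob (F : I -> \bar R) : measurable_fun setT F -> (forall t, 0 <= F t) ->
  \int[refprob]_t F t = \int[timelaw]_s \int[gauss n]_g F (s, g).
Proof. by move=> mF F0; rewrite /refprob fubini_tonelli1. Qed.

Lemma integral_gauss_obslik s x : \int[gauss n]_g (obslik ((s, g), x))%:E = 1.
Proof.
transitivity (\int[gauss n]_g ((gausslik (Num.sqrt s) g (Y x))%:E * cst 1 g)).
  by apply: eq_integral => g _; rewrite mule1.
rewrite integral_gausslik// integral_cst// mul1e.
exact: (@probability_setT _ _ _ (gauss n)).
Qed.

Lemma ge0_obslikE z : 0 <= (obslik z)%:E. Proof. by rewrite lee_fin ltW// obslik_gt0. Qed.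

Lemma measurable_obslikE : measurable_fun setT (fun z => (obslik z)%:E).
Proof. by apply/measurable_EFinP; exact: measurable_obslik. Qed.

Lemma integral_refprob_obslik x : \int[refprob]_t (obslik (t, x))%:E = 1.
Proof.
rewrite integral_refprob//; last 2 first.
- by apply: (measurableT_comp measurable_obslikE).
- by move=> t; exact: ge0_obslikE.
under eq_integral do rewrite integral_gauss_obslik.
by rewrite integral_cst// mul1e; exact: (@probability_setT _ _ _ timelaw).
Qed.

Lemma integral_obsmarg : \int[refprob]_t (obsmarg t)%:E = 1.
Proof.
under eq_integral do rewrite obsmargE.
rewrite (@fubini_tonelli _ _ _ _ _ refprob mu (fun z => (obslik z)%:E))/=.
- under eq_integral do rewrite integral_refprob_obslik.
  by rewrite integral_cst// mul1e; exact: probability_setT.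
- exact: measurable_obslikE.
- exact: ge0_obslikE.
Qed.

Lemma ex_channel : exists (m : probability I R) (mu_ : R.-pker I ~> T),
  is_density refprob m obsmarg /\
  forall t, is_density mu (mu_ t) (fun x => postden (t, x)).
Proof.
have [m dm] := ex_density_probability measurable_obsmarg
  (fun t => ltW (obsmarg_gt0 t)) integral_obsmarg.
have [mu_ dmu] := ex_density_kernel measurable_postden postden_ge0 integral_postden.
by exists m, mu_.
Qed.

Variables (m : probability I R) (mu_ : R.-pker I ~> T).
Hypothesis dm : is_density refprob m obsmarg.
Hypothesis dmu : forall t, is_density mu (mu_ t) (fun x => postden (t, x)).

(** By Bayes' rule the integral becomes the total mass of the likelihood at [x]. This is the
    condition for the posteriors to mix back to [mu]. *)
Lemma integral_m_postden x : \int[m]_t (postden (t, x))%:E = 1.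
Proof.
rewrite (ge0_integral_density dm)//.
- under eq_integral do rewrite -EFinM postdenM.
  exact: integral_refprob_obslik.
- by apply/measurable_EFinP; apply: (measurableT_comp measurable_postden).
- by move=> t; rewrite lee_fin postden_ge0.
Qed.

Lemma integral_mu_obsmarg t (F : T -> \bar R) : measurable_fun setT F -> (forall x, 0 <= F x) ->
  (\int[mu_ t]_x F x) * (obsmarg t)%:E = \int[mu]_x (F x * (obslik (t, x))%:E).
Proof.
move=> mF F0; rewrite (ge0_integral_density (dmu t))//.
have mden : measurable_fun setT (fun x => (postden (t, x))%:E).
  by apply/measurable_EFinP; apply: (measurableT_comp measurable_postden).
rewrite -ge0_integralZr//; last 3 first.
- exact: emeasurable_funM.
- by move=> x _; rewrite mule_ge0// lee_fin postden_ge0.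
- by rewrite lee_fin ltW// obsmarg_gt0.
by apply: eq_integral => x _; rewrite -muleA -EFinM postdenM.
Qed.

Lemma integral_m (F : I -> \bar R) : measurable_fun setT F -> (forall t, 0 <= F t) ->
  \int[m]_t F t = \int[timelaw]_s \int[gauss n]_g (F (s, g) * (obsmarg (s, g))%:E).
Proof.
move=> mF F0; rewrite (ge0_integral_density dm)// integral_refprob//.
- apply: emeasurable_funM => //.
  by apply/measurable_EFinP; exact: measurable_obsmarg.
- by move=> t; rewrite mule_ge0// lee_fin ltW// obsmarg_gt0.
Qed.

(* The two disintegrations of the joint law of [x] and [g] at time [s]. *)
Lemma integral_gauss_mu (F : n.-tuple R * T -> \bar R) s :
  measurable_fun setT F -> (forall z, 0 <= F z) ->
  \int[gauss n]_g (\int[mu_ (s, g)]_x F (g, x) * (obsmarg (s, g))%:E) =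
  \int[mu]_x \int[gauss n]_z F (combt 1 z (Num.sqrt s) (Y x), x).
Proof.
move=> mF F0.
have mF1 g : measurable_fun setT (fun x => F (g, x)) by apply: (measurableT_comp mF).
under eq_integral do rewrite integral_mu_obsmarg//.
rewrite (@fubini_tonelli _ _ _ _ _ (gauss n) mu
  (fun z => F z * (obslik ((s, z.1), z.2))%:E))/=; last 2 first.
- apply: emeasurable_funM => //; apply/measurable_EFinP.
  apply: (measurableT_comp measurable_obslik); apply: measurable_fun_pair => //.
  by apply: measurable_fun_pair => //.
- by move=> z; rewrite mule_ge0// ge0_obslikE.
apply: eq_integral => x _.
have mFx : measurable_fun setT (fun g => F (g, x)) by apply: (measurableT_comp mF).
rewrite -(integral_gausslik (Num.sqrt s) (Y x) mFx) => [|g]; last exact: F0.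
by apply: eq_integral => g _; rewrite muleC.
Qed.

Lemma integral_joint (F : I * T -> \bar R) :
  measurable_fun setT F -> (forall z, 0 <= F z) ->
  \int[m]_t \int[mu_ t]_x F (t, x) =
  \int[timelaw]_s \int[mu]_x \int[gauss n]_z F ((s, combt 1 z (Num.sqrt s) (Y x)), x).
Proof.
move=> mF F0; rewrite integral_m; last 2 first.
- exact: (measurable_integral_mixture measurable_postden postden_ge0 dmu).
- by move=> t; exact: integral_ge0.
apply: eq_integral => s _.
apply: (integral_gauss_mu (F := fun z => F ((s, z.1), z.2))) => //.
apply: (measurableT_comp mF); apply: measurable_fun_pair => //.
by apply: measurable_fun_pair.
Qed.

Lemma measurable_joint (F : I * T -> \bar R) :
  measurable_fun setT F -> (forall z, 0 <= F z) ->
  measurable_fun setT (fun u : measurableTypeR R * T =>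
    \int[gauss n]_z F ((u.1, combt 1 z (Num.sqrt u.1) (Y u.2)), u.2)).
Proof.
move=> mF F0.
suff mH : measurable_fun setT (fun w : (measurableTypeR R * T) * n.-tuple R =>
    F ((w.1.1, combt 1 w.2 (Num.sqrt w.1.1) (Y w.1.2)), w.1.2)).
  exact: (@measurable_fun_fubini_tonelli_F _ _ _ _ _ (gauss n) _ mH).
apply: (measurableT_comp mF); apply: measurable_fun_pair; last first.
  exact: (measurableT_comp measurable_snd measurable_fst).
apply: measurable_fun_pair.
  exact: (measurableT_comp measurable_fst measurable_fst).
apply/measurable_fun_tnthP => i.
rewrite [X in measurable_fun _ X](_ : _ = fun w : (measurableTypeR R * T) * n.-tuple R =>
    (1 * tnth w.2 i + Num.sqrt w.1.1 * tnth (Y w.1.2) i)%R); last first.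
  by apply/funext => w /=; rewrite tnth_mktuple.
apply: measurable_funD.
  apply: measurable_funM => //.
  exact: (measurableT_comp (measurable_tnth i) measurable_snd).
apply: measurable_funM.
  apply: (measurableT_comp measurable_sqrt).
  exact: (measurableT_comp measurable_fst measurable_fst).
apply: (measurableT_comp (measurable_tnth i)); apply: (measurableT_comp mY).
exact: (measurableT_comp measurable_snd measurable_fst).
Qed.

Lemma measurable_joint_at (F : I * T -> \bar R) s :
  measurable_fun setT F -> (forall z, 0 <= F z) ->
  measurable_fun setT (fun x =>
    \int[gauss n]_z F ((s, combt 1 z (Num.sqrt s) (Y x)), x)).
Proof.
move=> mF F0.
have := measurableT_comp (measurable_joint mF F0) (pair1_measurable s).
exact.
Qed.

Lemma measurable_joint_time (F : I * T -> \bar R) :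
  measurable_fun setT F -> (forall z, 0 <= F z) ->
  measurable_fun setT (fun s : measurableTypeR R => \int[mu]_x
    \int[gauss n]_z F ((s, combt 1 z (Num.sqrt s) (Y x)), x)).
Proof.
move=> mF F0.
apply: (@measurable_fun_fubini_tonelli_F _ _ _ _ _ mu _ (measurable_joint mF F0)).
by move=> u; exact: integral_ge0.
Qed.

End channel.

Section matrix_functions.
Context {d} {T : measurableType d} {R : realType}.

Definition mxmeasurable p q (F : T -> 'M[R]_(p, q)) :=
  forall i j, measurable_fun setT (fun x => F x i j).

Lemma mxmeasurable_cst p q (A : 'M[R]_(p, q)) : mxmeasurable (fun=> A).
Proof. by move=> i j; exact: measurable_cst. Qed.

Lemma mxmeasurable_mul p q r (F : T -> 'M[R]_(p, q)) (G : T -> 'M[R]_(q, r)) :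
  mxmeasurable F -> mxmeasurable G -> mxmeasurable (fun x => F x *m G x).
Proof.
move=> mF mG i j; under eq_fun do rewrite mxE.
by apply: measurable_sum => k; exact: measurable_funM.
Qed.

Lemma measurable_qform_mx n (F : T -> 'M[R]_n) v :
  mxmeasurable F -> measurable_fun setT (fun x => qform (F x) v).
Proof.
move=> mF; apply: (mxmeasurable_mul (mxmeasurable_mul (mxmeasurable_cst v^T) mF)).
exact: mxmeasurable_cst.
Qed.

Lemma measurable_mxtrace n (F : T -> 'M[R]_n) :
  mxmeasurable F -> measurable_fun setT (fun x => \tr (F x)).
Proof. by move=> mF; apply: measurable_sum => i; exact: mF. Qed.

Variable mu : {measure set T -> \bar R}.

Lemma qform_delta n (A : 'M[R]_n) i : qform A (delta_mx i 0) = A i i.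
Proof. by rewrite /qform trmx_delta -rowE -colE !mxE. Qed.

Lemma psd_entry_le n (A : 'M[R]_n) i j : possemidefmx A ->
  `|A i j| <= A i i + A j j.
Proof.
move=> [As Ap].
have H (e : R) : e ^+ 2 = 1 -> 0 <= A i i + A j j + 2 * e * A i j.
  move=> e2; have := Ap (delta_mx i 0 + e *: delta_mx j 0).
  rewrite [(_ + _)^T]linearD /= [(_ *: _)^T]linearZ /= !mulmxDl !mulmxDr.
  rewrite -!scalemxAl -!scalemxAr !trmx_delta.
  have D k l : delta_mx 0 k *m A *m delta_mx l 0 = (A k l)%:M :> 'M[R]_1.
    by rewrite [LHS]mx11_scalar -rowE -colE !mxE.
  rewrite !D !mxE eqxx !mulr1n.
  have -> : A j i = A i j by rewrite -{1}As mxE.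
  have -> : e * (e * A j j) = A j j by rewrite mulrA -expr2 e2 mul1r.
  lra.
have h1 := H 1 (expr1n _ _).
have h2 := H (-1) ltac:(by rewrite sqrrN expr1n).
have h3 : 0 <= A i i by rewrite -qform_delta; exact: Ap.
have h4 : 0 <= A j j by rewrite -qform_delta; exact: Ap.
by rewrite ler_norml; apply/andP; split; lra.
Qed.

(** Integrability is part of the conclusion: the hypothesis at basis vectors bounds the diagonal
    entries, and these dominate all the others by positive semidefiniteness. *)
Lemma loewner_mxintegral n (F : T -> 'M[R]_n) (B : 'M[R]_n) :
  mxmeasurable F -> (forall x, possemidefmx (F x)) -> B^T = B ->
  (forall v, (\int[mu]_x (qform (F x) v)%:E <= (qform B v)%:E)%E) ->
  mxintegrable mu F /\ loewner_le (mxintegral mu F) B.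
Proof.
move=> mF pF Bs FB.
have iq v : mu.-integrable setT (fun x => (qform (F x) v)%:E).
  apply: ge0_rintegrable.
  - exact: measurable_qform_mx.
  - by move=> x; have [_] := pF x; exact.
  - by rewrite (le_lt_trans (FB v))// ltry.
have iF : mxintegrable mu F.
  move=> i j; apply: (@le_rintegrable _ _ _ mu _ (fun x => F x i i + F x j j)) => //.
  - by move=> x; exact: psd_entry_le.
  - apply: rintegrableD.
    + by under eq_fun do rewrite -qform_delta.
    + by under eq_fun do rewrite -qform_delta.
split => //; split=> [|v].
  rewrite linearB /= Bs; congr (_ - _); apply/matrixP => i j; rewrite !mxE.
  by apply: eq_Rintegral => x _; have [Fs _] := pF x; rewrite -{1}Fs mxE.
rewrite -/(qform _ v) qformB subr_ge0 -Rintegral_qform//.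
by rewrite -lee_fin EFin_Rintegral.
Qed.

End matrix_functions.

(* Discrete form of the inequality [int_1^2 G <= f 1] for [G <= - f'] and [0 <= f]. *)
Lemma integral_step_le {R : realType} (f G : R -> \bar R) (V eps : R) :
  measurable_fun setT f -> measurable_fun setT G ->
  (forall t, 0 <= f t)%E -> (forall t, 0 <= G t)%E -> (forall t, f t <= V%:E)%E ->
  0 < eps -> eps <= 1 ->
  (forall t : R, (0 <= t)%R -> f (t + eps)%R + eps%:E * G t <= f t)%E ->
  (\int[lebesgue_measure]_(t in `[1%R, 2%R]) G t <= V%:E)%E.
Proof.
move=> mf mG f0 G0 fV eps0 eps1 step.
pose lam := @lebesgue_measure R.
have mfe : measurable_fun setT (fun t : R => f (t + eps)%R).
  by apply: (measurableT_comp mf); apply: measurable_funD.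
have meG : measurable_fun setT (fun t : R => eps%:E * G t)%E by exact: emeasurable_funM.
have eG0 t : (0 <= eps%:E * G t)%E by rewrite mule_ge0// lee_fin ltW.
(* The integral common to [f] and its translate over [1, 2]. Beyond it, the translate has a
   nonnegative remainder and [f] only a window of length [eps], which contributes at most
   [V * eps]. *)
pose B := (\int[lam]_(t in `[(1 + eps)%R, 2%R]) f t)%E.
have stepI : (\int[lam]_(t in `[1%R, 2%R]) f (t + eps)%R +
    eps%:E * \int[lam]_(t in `[1%R, 2%R]) G t <= \int[lam]_(t in `[1%R, 2%R]) f t)%E.
  rewrite -ge0_integralZl ?lee_fin ?(ltW eps0)//; last exact: measurable_funTS.
  rewrite -ge0_integralD//; try exact: measurable_funTS.
  apply: ge0_le_integral => //.
  - by move=> t _; rewrite adde_ge0.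
  - by apply: emeasurable_funD; exact: measurable_funTS.
  - exact: measurable_funTS.
  - by move=> t; rewrite /= in_itv/= => /andP[t1 _]; apply: step; exact: le_trans t1.
have trans : (\int[lam]_(t in `[1%R, 2%R]) f (t + eps)%R =
    \int[lam]_(t in `[(1 + eps)%R, (2 + eps)%R]) f t)%E.
  rewrite integral_mkcond [RHS]integral_mkcond.
  rewrite -[RHS](ge0_integral_lebesgue_translation eps).
  - apply: eq_integral => t _; rewrite !patchE.
    by rewrite !mem_setE !in_itv/= !lerD2r.
  - by apply/(measurable_restrictT _ _).1 => //; exact: measurable_funTS.
  - by move=> t; rewrite patchE; case: ifP.
have B_le : (B <= \int[lam]_(t in `[1%R, 2%R]) f (t + eps)%R)%E.
  rewrite trans; apply: ge0_subset_integral => //; first exact: measurable_funTS.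
  by apply: subset_itvl; rewrite bnd_simp; lra.
have f_le : (\int[lam]_(t in `[1%R, 2%R]) f t <= V%:E * eps%:E + B)%E.
  have -> : `[1%R, 2%R]%classic = (`[1%R, (1 + eps)%R[ `|` `[(1 + eps)%R, 2%R])%classic :> set R.
    apply/seteqP; split=> t /=; rewrite !in_itv/=.
      by move=> /andP[-> ->] /=; case: (ltP t (1 + eps)) => _; [left|right].
    by case=> /andP[t1 t2]; apply/andP; split; lra.
  rewrite ge0_integral_setU//; last 2 first.
  - exact: measurable_funTS.
  - apply/disj_setPS => t /= []; rewrite !in_itv/= => /andP[_ h1] /andP[h2 _].
    by have := lt_le_trans h1 h2; rewrite ltxx.
  rewrite leeD2r//.
  apply: (@le_trans _ _ (\int[lam]_(t in `[1%R, (1 + eps)%R[) V%:E)%E).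
    by apply: ge0_le_integral => //; exact: measurable_funTS.
  rewrite integral_cst//= lebesgue_measure_itv/= lte_fin ltrDl eps0 -EFinB.
  by rewrite addrAC subrr add0r.
(* Cancelling [B] from both sides is legitimate only when it is finite. *)
have Bfin : B \is a fin_num.
  rewrite ge0_fin_numE ?integral_ge0//.
  apply: (@le_lt_trans _ _ (\int[lam]_(t in `[(1 + eps)%R, 2%R]) V%:E)%E).
    by apply: ge0_le_integral => //; exact: measurable_funTS.
  rewrite integral_cst//= lebesgue_measure_itv/=; case: ifP => _.
    by rewrite -EFinB -EFinM ltry.
  by rewrite mule0 ltry.
have : (B + eps%:E * \int[lam]_(t in `[1%R, 2%R]) G t <= B + eps%:E * V%:E)%E.
  apply: le_trans (leeD2r _ B_le) _; apply: le_trans stepI _.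
  by rewrite addeC muleC.
by rewrite leeD2lE// lee_pmul2l// lte_fin.
Qed.

(** * Bounds on the posterior covariances *)

Section vector_channel.
Context {R : realType} {n : nat}.
Local Notation I := (measurableTypeR R * n.-tuple R)%type.
Variables (mu : probability (n.-tuple R) R) (M : 'M[R]_n).
Hypotheses (cov_mu : cov_exists mu) (Mu : M \in unitmx).

Let a := meanvec mu.
Let S := covmx mu.
Let mu1 : mu setT = 1%E. Proof. exact: (@probability_setT _ _ _ mu). Qed.

(** These coordinates turn the form [M^T *m M] into the identity; their covariance is M Cov(mu) M^T,
    not the identity. Centring matches the centred Gaussian used for the entropy bound. *)
Definition whiten (x : n.-tuple R) : n.-tuple R := tvec (M *m (colvec x - a)).

Lemma measurable_whiten : measurable_fun setT whiten.
Proof.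
apply/measurable_fun_tnthP => i.
rewrite [X in measurable_fun _ X](_ : _ = fun x => (row i M *m colvec x) 0 0 - (row i M *m a) 0 0).
  by apply: measurable_funB => //; exact: measurable_rowmul.
apply/funext => x /=; rewrite tnth_mktuple mulmxBr !mxE; congr (_ - _).
- by apply: eq_bigr => j _; rewrite !mxE.
- by apply: eq_bigr => j _; rewrite !mxE.
Qed.

Lemma dotp_whiten c x : dotp c (whiten x) =
  ((M^T *m colvec c)^T *m colvec x) 0 0 - ((M^T *m colvec c)^T *m a) 0 0.
Proof. by rewrite dotpE tvecK mulmxA mulmxBr trmx_mul trmxK !mxE. Qed.

(** The estimator corrects the guess [v . b] by [c] applied to the innovation, that is, the new
    observation minus its prediction [e M (b - a)]. Its error splits into a part in [x] with
    direction [w] and a part in the noise [z]. *)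
Lemma estimator_residual (v c b : 'cV[R]_n) e z x :
  let w := v - e *: (M^T *m c) in
  (v^T *m colvec x) 0 0 - ((v^T *m b) 0 0 + dotp (tvec c) (combt 1 z e (whiten x)) -
    e * ((M^T *m c)^T *m (b - a)) 0 0) =
  (w^T *m colvec x) 0 0 - (w^T *m b) 0 0 + dotp (tvec (- c)) z.
Proof.
move=> w.
have cE : dotp (tvec (- c)) z = - dotp (tvec c) z.
  by rewrite !dotpE !tvecK [(- c)^T]linearN mulNmx mxE.
have D1 (X Z : 'M[R]_1) : (X - Z) 0 0 = X 0 0 - Z 0 0 by rewrite !mxE.
have D (X Z : 'M[R]_1) k : (X - k *: Z) 0 0 = X 0 0 - k * Z 0 0 by rewrite !mxE.
have wE (y : 'cV[R]_n) : (w^T *m y) 0 0 = (v^T *m y) 0 0 - e * ((M^T *m c)^T *m y) 0 0.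
  by rewrite /w [(_ - _)^T]linearB /= [(_ *: _)^T]linearZ /= mulmxBl -scalemxAl D.
rewrite cE !wE dotp_combr dotp_whiten tvecK mulmxBr.
by rewrite D1; ring.
Qed.

Lemma whiten_integrable c : mu.-integrable setT (fun x => (dotp c (whiten x))%:E).
Proof.
under eq_fun do rewrite dotp_whiten.
apply: rintegrableB; last exact: rintegrable_cst_mass1.
by apply: rowmul_integrable; case: cov_mu.
Qed.

Lemma whiten_sqr_integrable c :
  mu.-integrable setT (fun x => ((dotp c (whiten x)) ^+ 2)%:E).
Proof.
under eq_fun do rewrite dotp_whiten.
exact: sqdev_integrable.
Qed.

Lemma Rintegral_whiten_sqr c :
  \int[mu]_x (dotp c (whiten x)) ^+ 2 = qform S (M^T *m colvec c).
Proof.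
under eq_Rintegral do rewrite dotp_whiten.
by rewrite Rintegral_sqdev// subrr expr0n addr0.
Qed.

Lemma dotp_basis (y : n.-tuple R) :
  dotp y y = \sum_i dotp (tvec (delta_mx i 0)) y ^+ 2.
Proof.
apply: eq_bigr => i _; rewrite -expr2; congr (_ ^+ 2).
rewrite /dotp (bigD1 i)//= tnth_mktuple mxE !eqxx mul1r big1 ?addr0// => j ji.
by rewrite tnth_mktuple mxE (negbTE ji) mul0r.
Qed.

Lemma whiten_norm_integrable :
  mu.-integrable setT (fun x => (dotp (whiten x) (whiten x))%:E).
Proof.
under eq_fun do rewrite dotp_basis.
by apply: rintegrable_sum => i; exact: whiten_sqr_integrable.
Qed.

Let mY := measurable_whiten.
Let iY := whiten_integrable.
Let iYY := whiten_norm_integrable.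

Variables (m : probability I R) (mu_ : R.-pker I ~> (n.-tuple R)).
Hypothesis dm : is_density (@refprob R n) m (obsmarg mu whiten).
Hypothesis dmu : forall t, is_density mu (mu_ t) (fun x => postden mu whiten (t, x)).

Let mden := measurable_postden mY iY iYY.
Let den0 := postden_ge0 mY iY iYY.
Let denB := postden_bounded mY iY iYY.
Let mint := integral_m_postden mY iY iYY dm.

Lemma channel_mass1 t : mu_ t setT = 1%E. Proof. exact: prob_kernel. Qed.

Lemma channel_cov_exists t : cov_exists (mu_ t).
Proof.
have [i1 i2] := cov_mu; split=> i j.
- exact: (mixture_integrable mden den0 dmu denB (i1 i j)).
- exact: (mixture_integrable mden den0 dmu denB (i2 i j)).
Qed.

Lemma channel_psd t : possemidefmx (covmx (mu_ t)).
Proof. exact: covmx_psd (channel_mass1 t) (channel_cov_exists t). Qed.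

Lemma measurable_channel_Rintegral f : mu.-integrable setT (fun x => (f x)%:E) ->
  measurable_fun setT (fun t => \int[mu_ t]_x f x).
Proof.
move=> fi; apply: rintegrable_measurable.
exact: (mixture_Rintegral_integrable mden den0 dmu mint denB fi).
Qed.

Lemma mxmeasurable_channel_cov : mxmeasurable (fun t => covmx (mu_ t)).
Proof.
have [i1 i2] := cov_mu => i j.
rewrite /covmx /mxintegral /outer_square.
under eq_fun do rewrite !mxE big_ord1 !mxE.
apply: measurable_funB; first exact: measurable_channel_Rintegral (i2 i j).
by apply: measurable_funM; exact: measurable_channel_Rintegral.
Qed.

(** The value [b] may be chosen depending on [t], so after averaging over [m] this compares the
    posterior covariance with an arbitrary estimator. *)
Lemma channel_cov_le t v b :
  ((qform (covmx (mu_ t)) v)%:E <=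
   \int[mu_ t]_x ((((v^T *m colvec x) 0 0 - b) ^+ 2)%:E))%E.
Proof.
have c1 := channel_mass1 t; have ce := channel_cov_exists t.
rewrite -EFin_Rintegral; last exact: sqdev_integrable.
by rewrite lee_fin Rintegral_sqdev// lerDl sqr_ge0.
Qed.

Local Open Scope ereal_scope.

Lemma timelaw_le_cst (F : R -> \bar R) (C : R) : measurable_fun setT F ->
  (forall t, 0 <= F t) -> (forall t, (1 <= t <= 2)%R -> F t <= C%:E) ->
  \int[timelaw]_t F t <= C%:E.
Proof.
move=> mF F0 FC; rewrite /timelaw integral_uniform//.
have E21 : (2 - 1 = 1 :> R)%R by ring.
rewrite E21.
rewrite invr1 mul1e.
apply: (@le_trans _ _ (\int[lebesgue_measure]_(t in `[1%R, 2%R]) C%:E)).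
  apply: ge0_le_integral => //; first exact: measurable_funTS.
rewrite integral_cst//= lebesgue_measure_itv/= lte_fin ltr1n -EFinB.
by rewrite E21 mule1.
Qed.

Lemma measurable_rowmul_tuple d (X : measurableType d) (r : 'rV[R]_n) (f : X -> n.-tuple R) :
  measurable_fun setT f -> measurable_fun setT (fun x => (r *m colvec (f x)) 0%R 0%R).
Proof. by move=> mf; exact: (measurableT_comp (measurable_rowmul r) mf). Qed.

(** The estimator is [v . a + e . g / sqrt t], where [e] is chosen so that [e . Y(x) = v . (x - a)].
    Only the noise [- e . z / sqrt t] remains as error, with variance at most [|e|^2], the quadratic
    form of the inverse of [M^T *m M] at [v]. *)
Lemma integral_channel_cov v :
  \int[m]_t (qform (covmx (mu_ t)) v)%:E <= (qform (invmx (M^T *m M)) v)%:E.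
Proof.
pose e := tvec (invmx M^T *m v).
have MTu : M^T \in unitmx by rewrite unitmx_tr.
have eE x : (dotp e (whiten x) = (v^T *m colvec x) 0%R 0%R - (v^T *m a) 0%R 0%R)%R.
  by rewrite dotp_whiten tvecK mulKVmx.
have qE : qform (invmx (M^T *m M)) v = dotp e e.
  rewrite dotpE tvecK trmx_mul trmx_inv trmxK /qform.
  have u : M^T *m M \in unitmx by rewrite unitmx_mul MTu.
  have -> : invmx (M^T *m M) = invmx M *m invmx M^T.
    have E1 : M^T *m M *m (invmx M *m invmx M^T) = 1%:M.
      by rewrite mulmxA mulmxK// mulmxV.
    by rewrite -[RHS](mulKmx u) E1 mulmx1.
  by rewrite !mulmxA.
(* This equals [1 / sqrt t] for positive [t]; other values do not matter, since [timelaw] is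
   supported on [1, 2]. *)
pose rho (t : R) := expR (- ln (Num.sqrt t)).
pose b (t : I) := ((v^T *m a) 0%R 0%R + rho t.1 * dotp e t.2)%R.
pose F (z : I * n.-tuple R) := (((v^T *m colvec z.2) 0%R 0%R - b z.1) ^+ 2)%:E.
have mrho : measurable_fun setT rho.
  apply: (measurableT_comp (@measurable_expR R)); apply: measurable_funN.
  by apply: (measurableT_comp (@measurable_ln R)); exact: measurable_sqrt.
have mF : measurable_fun setT F.
  apply/measurable_EFinP/measurable_funX/measurable_funB.
    exact: measurable_rowmul_tuple.
  apply: measurable_funD => //; apply: measurable_funM.
    apply: (measurableT_comp mrho).
    exact: (measurableT_comp measurable_fst measurable_fst).
  apply: measurable_dotp => //.
  exact: (measurableT_comp measurable_snd measurable_fst).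
have F0 z : 0 <= F z by rewrite lee_fin sqr_ge0.
apply: (@le_trans _ _ (\int[m]_t \int[mu_ t]_x F (t, x))).
  apply: ge0_le_integral => //.
  - by move=> t _; rewrite lee_fin; have [_] := channel_psd t; exact.
  - by apply/measurable_EFinP; exact: measurable_qform_mx mxmeasurable_channel_cov.
  - exact: (measurable_integral_mixture mden den0 dmu).
  - by move=> t _; exact: (channel_cov_le t v (b t)).
rewrite (integral_joint mY iY iYY dm dmu)//.
apply: timelaw_le_cst.
- exact: (measurable_joint_time mu mY mF F0).
- by move=> t; do 2 (apply: integral_ge0 => ? _).
move=> t /andP[t1 t2].
have s0 : (0 < Num.sqrt t)%R by rewrite sqrtr_gt0 (lt_le_trans ltr01).
have s1 : ((Num.sqrt t)^-1 ^+ 2 <= 1)%R.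
  by rewrite exprVn sqr_sqrtr ?(le_trans ler01)// invf_le1// (lt_le_trans ltr01).
rewrite -[leRHS]mule1 -[X in _ * X]mu1 -integral_cst//.
apply: ge0_le_integral => //.
- by move=> x _; apply: integral_ge0.
- exact: (measurable_joint_at mY t mF F0).
move=> x _; rewrite qE.
rewrite [leLHS](_ : _ = \int[gauss n]_z
    ((0 + dotp (combt (- (Num.sqrt t)^-1) e 0 e) z) ^+ 2)%:E); last first.
  apply: eq_integral => z _.
  rewrite /F /b /=; congr ((_ ^+ 2)%:E).
  rewrite opprD addrA -eE /rho expRN lnK ?posrE//.
  rewrite dotp_combr dotp_combl; field.
  by rewrite gt_eqF.
rewrite integral_gauss_sqr lee_fin expr0n add0r dotp_combl !dotp_combr.
rewrite !mul0r !addr0 mulrA mulrNN -expr2 -[leRHS]mul1r.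
by rewrite ler_wpM2r// dotp_ge0.
Qed.

Variable v : 'cV[R]_n.

(* The posterior covariance in direction [v], averaged over the observations made
   at time [t]; [gain e] bounds from below its rate of decrease when an observation
   at time [e ^+ 2] is added. *)
Definition avgcov (t : R) : \bar R := \int[gauss n]_g
  ((qform (covmx (mu_ (t, g))) v)%:E * (obsmarg mu whiten (t, g))%:E).

Definition gain (e : R) (t : I) : R := let A := covmx (mu_ t) in
  qform (A *m (M^T *m M) *m A) v / (1 + e ^+ 2 * \tr (M *m A *m M^T)).

Let marg_gt0 := obsmarg_gt0 mY iY iYY.

Let margE_ge0 t : 0 <= (obsmarg mu whiten t)%:E.
Proof. by rewrite lee_fin ltW// marg_gt0. Qed.

Let covE_ge0 t w : 0 <= (qform (covmx (mu_ t)) w)%:E.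
Proof. by rewrite lee_fin; have [_] := channel_psd t; exact. Qed.

Let mmarg : measurable_fun setT (fun t => (obsmarg mu whiten t)%:E).
Proof. by apply/measurable_EFinP; exact: measurable_obsmarg mY. Qed.

Let mcov w : measurable_fun setT (fun t => (qform (covmx (mu_ t)) w)%:E).
Proof. by apply/measurable_EFinP; exact: measurable_qform_mx mxmeasurable_channel_cov. Qed.

Let mcovmarg : measurable_fun setT
  (fun t => (qform (covmx (mu_ t)) v)%:E * (obsmarg mu whiten t)%:E).
Proof. exact: emeasurable_funM. Qed.

Let covmarg_ge0 t : 0 <= (qform (covmx (mu_ t)) v)%:E * (obsmarg mu whiten t)%:E.
Proof. exact: mule_ge0. Qed.

Lemma measurable_avgcov : measurable_fun setT avgcov.
Proof. exact: (measurable_integral_gauss (T := measurableTypeR R) mcovmarg). Qed.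

Lemma avgcov_ge0 t : 0 <= avgcov t.
Proof. by apply: integral_ge0. Qed.

Let msq b : measurable_fun setT (fun z : n.-tuple R * n.-tuple R =>
  ((((v^T *m colvec z.2) 0%R 0%R - b) ^+ 2)%:E)).
Proof.
apply/measurable_EFinP/measurable_funX/measurable_funB => //.
exact: measurable_rowmul_tuple.
Qed.

Let msqmix b : measurable_fun setT (fun t : I =>
  \int[mu_ t]_x ((((v^T *m colvec x) 0%R 0%R - b) ^+ 2)%:E)).
Proof.
suff mF : measurable_fun setT (fun z : I * n.-tuple R =>
    ((((v^T *m colvec z.2) 0%R 0%R - b) ^+ 2)%:E)).
  apply: (measurable_integral_mixture mden den0 dmu mF) => z.
  by rewrite lee_fin sqr_ge0.
apply/measurable_EFinP/measurable_funX/measurable_funB => //.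
exact: measurable_rowmul_tuple.
Qed.

Let gauss1T : gauss n setT = 1 :> \bar R.
Proof. exact: (@probability_setT _ _ _ (gauss n)). Qed.

(** The comparison estimator ignores the observation: it is the prior mean of [v . x]. *)
Lemma avgcov_le t : avgcov t <= (qform S v)%:E.
Proof.
pose b := (v^T *m a) 0%R 0%R.
apply: (@le_trans _ _ (\int[gauss n]_g (\int[mu_ (t, g)]_x
    ((((v^T *m colvec x) 0%R 0%R - b) ^+ 2)%:E) * (obsmarg mu whiten (t, g))%:E))).
  apply: ge0_le_integral; [by []|by []| | |].
  - exact: (measurableT_comp mcovmarg (pair1_measurable t)).
  - apply: emeasurable_funM; last exact: (measurableT_comp mmarg (pair1_measurable t)).
    exact: (measurableT_comp (msqmix b) (pair1_measurable t)).
  - by move=> g _; rewrite lee_wpmul2r// channel_cov_le.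
rewrite (integral_gauss_mu mY iY iYY dmu (F := fun z => _) t (msq b)); last first.
  by move=> z; rewrite lee_fin sqr_ge0.
under eq_integral do rewrite /= integral_cst// [X in _ * X]gauss1T mule1.
rewrite -EFin_Rintegral; last exact: sqdev_integrable.
by rewrite Rintegral_sqdev// -/a subrr expr0n addr0.
Qed.

(* Observations at times [t] and [e ^+ 2] combine into one at time [t + e ^+ 2]. *)
Definition rotg (t e : R) (g h : n.-tuple R) : n.-tuple R :=
  combt (Num.sqrt t / Num.sqrt (t + e ^+ 2)) g (e / Num.sqrt (t + e ^+ 2)) h.

(* The estimator [b] of [v . x] is linear in the additional observation [h]. *)
Lemma rotated_cov_le t e g (c : 'cV[R]_n) : (0 <= t)%R -> (0 < e)%R ->
  \int[gauss n]_h ((qform (covmx (mu_ (t + e ^+ 2, rotg t e g h)%R)) v)%:E *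
     (obsmarg mu whiten (t + e ^+ 2, rotg t e g h)%R)%:E) <=
  (qform (covmx (mu_ (t, g))) (v - e *: (M^T *m c)) + dotp (tvec c) (tvec c))%:E *
    (obsmarg mu whiten (t, g))%:E.
Proof.
move=> t0 e0; pose u := Num.sqrt (t + e ^+ 2); pose g' := rotg t e g.
set A := covmx (mu_ (t, g)); set w := (v - _)%R.
have e20 : (0 < e ^+ 2)%R by rewrite exprn_gt0.
have u0 : (0 < u)%R by rewrite sqrtr_gt0 ltr_wpDl.
have seu : (Num.sqrt t ^+ 2 + e ^+ 2 = u ^+ 2)%R.
  by rewrite /u !sqr_sqrtr// addr_ge0// ltW.
pose at_ := meanvec (mu_ (t, g)).
pose b h := ((v^T *m at_) 0%R 0%R + dotp (tvec c) h -
  e * ((M^T *m c)^T *m (at_ - a)) 0%R 0%R)%R.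
pose sq (z : n.-tuple R * n.-tuple R) :=
  (((v^T *m colvec z.2) 0%R 0%R - b z.1) ^+ 2)%:E.
have sq0 z : 0 <= sq z by rewrite lee_fin sqr_ge0.
have msqz : measurable_fun setT sq.
  apply/measurable_EFinP/measurable_funX/measurable_funB.
    exact: measurable_rowmul_tuple.
  by apply: measurable_funB => //; apply: measurable_funD => //; vfun.
have mmg' : measurable_fun setT g' by rewrite /g' /rotg; vfun.
have mlik2 : measurable_fun setT (fun z : n.-tuple R * n.-tuple R =>
    (gausslik u (g' z.1) (whiten z.2))%:E).
  apply/measurable_EFinP; apply: measurable_gausslik => //.
  - exact: (measurableT_comp mmg').
  - exact: (measurableT_comp mY).
have lik0 h x : 0 <= (gausslik u (g' h) (whiten x))%:E by rewrite lee_fin ltW// gausslik_gt0.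
apply: (@le_trans _ _ (\int[gauss n]_h \int[mu]_x
    (sq (h, x) * (gausslik u (g' h) (whiten x))%:E))).
  apply: ge0_le_integral.
  - exact: measurableT.
  - by move=> h _; exact: covmarg_ge0.
  - apply: (measurableT_comp (mcovmarg)); apply: measurable_fun_pair => //.
  - apply: (@measurable_fun_fubini_tonelli_F _ _ _ _ _ mu
      (fun z => sq z * (gausslik u (g' z.1) (whiten z.2))%:E)).
    + exact: emeasurable_funM.
    + by move=> z; exact: mule_ge0.
  - move=> h _.
    have msqh : measurable_fun setT (fun x => sq (h, x)).
      exact: (measurableT_comp msqz (pair1_measurable h)).
    have E := integral_mu_obsmarg mY iY iYY dmu (t + e ^+ 2, g' h)%R msqh (fun x => sq0 (h, x)).
    apply: (@le_trans _ _ (\int[mu_ (t + e ^+ 2, g' h)%R]_x sq (h, x) *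
        (obsmarg mu whiten (t + e ^+ 2, g' h)%R)%:E)); last by rewrite E.
    apply: lee_wpmul2r; first exact: margE_ge0.
    exact: (channel_cov_le (t + e ^+ 2, g' h)%R v (b h)).
rewrite (@fubini_tonelli _ _ _ _ _ (gauss n) mu
  (fun z => sq z * (gausslik u (g' z.1) (whiten z.2))%:E))/=; last 2 first.
- exact: emeasurable_funM.
- by move=> z; exact: mule_ge0.
have msqx x : measurable_fun setT (fun h => sq (h, x)).
  exact: (measurableT_comp msqz (pair2_measurable x)).
rewrite (eq_integral (fun x => (((w^T *m colvec x) 0%R 0%R - (w^T *m at_) 0%R 0%R) ^+ 2 +
    dotp (tvec c) (tvec c))%:E * (obslik whiten ((t, g), x))%:E)); last first.
  move=> x _.
  (* The likelihood at time [t + e ^+ 2] splits: the factor in [g] leaves the integral, and the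
     factor in [h] makes [h] a fresh observation [z + e Y(x)], to which the estimator applies. *)
  transitivity (\int[gauss n]_h ((gausslik (Num.sqrt t) g (whiten x))%:E *
      ((gausslik e h (whiten x))%:E * sq (h, x)))).
    apply: eq_integral => h _; rewrite /g' /rotg gausslik_rotation ?gt_eqF//.
    by rewrite EFinM muleC muleA.
  rewrite ge0_integralZl//; [| |
    by move=> h _; rewrite mule_ge0// lee_fin ltW// gausslik_gt0|
    by rewrite lee_fin ltW// gausslik_gt0];
    last by apply: emeasurable_funM => //; apply/measurable_EFinP; exact: measurable_gausslik.
  rewrite integral_gausslik// muleC; congr (_ * _).
  transitivity (\int[gauss n]_z ((((w^T *m colvec x) 0%R 0%R - (w^T *m at_) 0%R 0%R) +
      dotp (tvec (- c)) z) ^+ 2)%:E).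
    apply: eq_integral => z _; rewrite /sq /b /=; congr ((_ ^+ 2)%:E).
    exact: estimator_residual.
  rewrite integral_gauss_sqr.
  by congr (_ + _)%:E; rewrite !dotpE !tvecK [(- c)^T]linearN /= mulNmx mulmxN opprK.
have mF : measurable_fun setT (fun x => (((w^T *m colvec x) 0%R 0%R -
    (w^T *m at_) 0%R 0%R) ^+ 2 + dotp (tvec c) (tvec c))%:E).
  apply/measurable_EFinP/measurable_funD => //; apply/measurable_funX/measurable_funB => //.
  exact: measurable_rowmul.
rewrite -(integral_mu_obsmarg mY iY iYY dmu (t, g) mF) => [|x]; last first.
  by rewrite lee_fin addr_ge0 ?sqr_ge0// dotp_ge0.
have c1 := channel_mass1 (t, g); have ce := channel_cov_exists (t, g).
have i1 := sqdev_integrable c1 ce w ((w^T *m at_) 0%R 0%R).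
have i2 := rintegrable_cst_mass1 c1 (dotp (tvec c) (tvec c)).
apply: lee_wpmul2r; first exact: margE_ge0.
rewrite -EFin_Rintegral; last exact: rintegrableD.
rewrite lee_fin RintegralD// Rintegral_sqdev// subrr expr0n addr0.
by rewrite (Rintegral_cst_mass1 c1).
Qed.

Lemma gain_den_gt0 e t : (0 < 1 + e ^+ 2 * \tr (M *m covmx (mu_ t) *m M^T))%R.
Proof.
rewrite ltr_pwDl// mulr_ge0 ?sqr_ge0//.
exact/psd_trace_ge0/possemidefmx_conj/channel_psd.
Qed.

Lemma gain_ge0 e t : (0 <= gain e t)%R.
Proof.
have [As _] := channel_psd t.
by rewrite divr_ge0 ?(ltW (gain_den_gt0 _ _))// qform_sandwich// dotp_ge0.
Qed.

Lemma mxmeasurable_sandwich : mxmeasurable (fun t =>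
  covmx (mu_ t) *m (M^T *m M) *m covmx (mu_ t)).
Proof.
apply: mxmeasurable_mul mxmeasurable_channel_cov.
apply: mxmeasurable_mul mxmeasurable_channel_cov _.
exact: mxmeasurable_cst.
Qed.

Lemma measurable_gain e : measurable_fun setT (gain e).
Proof.
have -> : gain e = (fun t => qform (covmx (mu_ t) *m (M^T *m M) *m covmx (mu_ t)) v *
    expR (- ln (1 + e ^+ 2 * \tr (M *m covmx (mu_ t) *m M^T))))%R.
  by apply/funext => t; rewrite expRN lnK// posrE gain_den_gt0.
apply: measurable_funM; first exact: measurable_qform_mx mxmeasurable_sandwich.
apply: (measurableT_comp (@measurable_expR R)); apply: measurable_funN.
apply: (measurableT_comp (@measurable_ln R)); apply: measurable_funD => //.
apply: measurable_funM => //; apply: measurable_mxtrace.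
apply: mxmeasurable_mul (mxmeasurable_cst _).
exact: mxmeasurable_mul (mxmeasurable_cst _) mxmeasurable_channel_cov.
Qed.

(** Rotation invariance rewrites the average at the later time over pairs [(g, h)]. For each fixed
    [g], the error of the linear estimator in [h] is then controlled by [qform_variance_gain]. *)
Lemma avgcov_step t e : (0 <= t)%R -> (0 < e)%R ->
  avgcov (t + e ^+ 2) + \int[gauss n]_g ((e ^+ 2 * gain e (t, g))%:E *
    (obsmarg mu whiten (t, g))%:E) <= avgcov t.
Proof.
move=> t0 e0; pose s := Num.sqrt t; pose u := Num.sqrt (t + e ^+ 2).
have e20 : (0 < e ^+ 2)%R by rewrite exprn_gt0.
have u0 : (0 < u)%R by rewrite sqrtr_gt0 ltr_wpDl.
have seu : (s ^+ 2 + e ^+ 2 = u ^+ 2)%R.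
  by rewrite /s /u !sqr_sqrtr// addr_ge0// ltW.
have ab : ((s / u) ^+ 2 + (e / u) ^+ 2 = 1)%R.
  by rewrite !expr_div_n -mulrDl seu divff// gt_eqF// exprn_gt0.
pose H g := (qform (covmx (mu_ (t + e ^+ 2, g)%R)) v)%:E *
  (obsmarg mu whiten (t + e ^+ 2, g)%R)%:E.
have mH : measurable_fun setT H.
  exact: (measurableT_comp mcovmarg (pair1_measurable (t + e ^+ 2)%R)).
have H0 g : 0 <= H g by exact: covmarg_ge0.
pose H2 g := \int[gauss n]_h H (rotg t e g h).
have mH2 : measurable_fun setT H2.
  have mHH : measurable_fun setT (fun z : n.-tuple R * n.-tuple R => H (rotg t e z.1 z.2)).
    by apply: (measurableT_comp mH); rewrite /rotg; vfun.
  exact: (measurable_integral_gauss (T := n.-tuple R) mHH (fun z => H0 _)).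
have H20 g : 0 <= H2 g by exact: integral_ge0.
have -> : avgcov (t + e ^+ 2) = \int[gauss n]_g H2 g.
  by rewrite (integral_gauss_rotation ab _ mH H0)// divr_gt0.
pose G g := (e ^+ 2 * gain e (t, g))%:E * (obsmarg mu whiten (t, g))%:E.
have mG : measurable_fun setT G.
  apply: emeasurable_funM; last exact: (measurableT_comp mmarg (pair1_measurable t)).
  apply/measurable_EFinP/measurable_funM => //.
  exact: (measurableT_comp (measurable_gain e) (pair1_measurable t)).
have G0 g : 0 <= G g by rewrite mule_ge0// lee_fin mulr_ge0 ?gain_ge0// ltW.
rewrite -(ge0_integralD (gauss n) measurableT (fun g _ => H20 g) mH2 (fun g _ => G0 g) mG).
apply: ge0_le_integral.
- exact: measurableT.
- by move=> g _; exact: (adde_ge0 (H20 g) (G0 g)).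
- exact: emeasurable_funD.
- exact: (measurableT_comp mcovmarg (pair1_measurable t)).
move=> g _.
pose A := covmx (mu_ (t, g)).
pose c := ((e / (1 + e ^+ 2 * \tr (M *m A *m M^T))) *: (M *m A *m v))%R.
pose w := (v - e *: (M^T *m c))%R.
apply: (@le_trans _ _ ((qform A w + dotp (tvec c) (tvec c))%:E *
    (obsmarg mu whiten (t, g))%:E + G g)).
  by apply: leeD2r; exact: rotated_cov_le.
rewrite -!EFinM -EFinD lee_fin -mulrDl; apply: ler_wpM2r; first exact/ltW/marg_gt0.
exact: (qform_variance_gain M v (channel_psd (t, g)) (ltW e0)).
Qed.

Lemma integral_gain e : (0 < e <= 1)%R -> \int[m]_t (gain e t)%:E <= (qform S v)%:E.
Proof.
move=> /andP[e0 e1].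
have mg : measurable_fun setT (fun t => (gain e t)%:E).
  by apply/measurable_EFinP; exact: measurable_gain.
rewrite (integral_m mY iY iYY dm)//; last by move=> t; rewrite lee_fin gain_ge0.
pose G t := \int[gauss n]_g ((gain e (t, g))%:E * (obsmarg mu whiten (t, g))%:E).
have gm0 t : 0 <= (gain e t)%:E * (obsmarg mu whiten t)%:E.
  by rewrite mule_ge0// lee_fin gain_ge0.
have mgm : measurable_fun setT (fun t => (gain e t)%:E * (obsmarg mu whiten t)%:E).
  exact: emeasurable_funM.
have mG : measurable_fun setT G.
  exact: (measurable_integral_gauss (T := measurableTypeR R) mgm gm0).
have G0 t : 0 <= G t by exact: integral_ge0.
rewrite [leLHS](_ : _ = \int[timelaw]_s G s)// /timelaw integral_uniform//.
rewrite (_ : (2 - 1)^-1 = 1 :> R)%R ?mul1e; last by rewrite (_ : 2 - 1 = 1)%R ?invr1//; ring.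
have e20 : (0 < e ^+ 2)%R by rewrite exprn_gt0.
(* The step in time is [e ^+ 2], the strength of the additional observation, and [V] is the prior
   variance in direction [v]. *)
apply: (integral_step_le measurable_avgcov mG avgcov_ge0 G0 avgcov_le e20).
  by rewrite expr_le1// ltW.
move=> t t0; apply: le_trans (avgcov_step t0 e0); rewrite le_eqVlt; apply/orP; left; apply/eqP.
congr (_ + _); rewrite /G -ge0_integralZl//.
- by apply: eq_integral => g _; rewrite EFinM muleA.
- exact: (measurableT_comp mgm (pair1_measurable t)).
- by rewrite lee_fin ltW.
Qed.

(** As [e] decreases to 0, the denominator of [gain] decreases to 1, so [gain] increases to the
    integrand and the uniform bound survives by monotone convergence. *)
Lemma integral_sandwich :
  \int[m]_t (qform (covmx (mu_ t) *m (M^T *m M) *m covmx (mu_ t)) v)%:E <= (qform S v)%:E.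
Proof.
(* So [e k ^+ 2 = 1 / (k + 1)], which never exceeds 1, as [integral_gain] requires. *)
pose e k : R := Num.sqrt (harmonic k).
have h0 k : (0 < harmonic k :> R)%R by rewrite /harmonic invr_gt0.
have e2 k : (e k ^+ 2 = harmonic k)%R by rewrite sqr_sqrtr// ltW.
have e01 k : (0 < e k <= 1)%R.
  rewrite sqrtr_gt0 h0 /= -[leRHS]sqrtr1 ler_sqrt//.
  by rewrite /harmonic invf_le1// ler1n.
pose g k t := (gain (e k) t)%:E.
have glim t : g ^~ t @ \oo --> (qform (covmx (mu_ t) *m (M^T *m M) *m covmx (mu_ t)) v)%:E.
  apply: cvg_EFin; first by near=> k.
  set A := covmx (mu_ t); set q := qform _ v; set r := \tr (M *m A *m M^T).
  have c0 : (harmonic k * r)%R @[k --> \oo] --> (0 * r)%R.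
    by apply: cvgMl; exact: cvg_harmonic.
  have c1 : (1 + harmonic k * r)%R @[k --> \oo] --> (1 + 0 * r)%R.
    by apply: cvgD => //; exact: cvg_cst.
  have c2 : (q / (1 + harmonic k * r))%R @[k --> \oo] --> (q / (1 + 0 * r))%R.
    apply: cvgM; first exact: cvg_cst.
    by apply: cvgV => //; rewrite mul0r addr0 oner_neq0.
  rewrite mul0r addr0 divr1 in c2.
  have -> : fine \o g ^~ t = (fun k => q / (1 + harmonic k * r))%R.
    by apply/funext => k; rewrite /g /gain /= e2.
  exact: c2.
have gnd t : {homo g ^~ t : k l / (k <= l)%N >-> k <= l}.
  move=> k l kl; rewrite lee_fin /gain; apply: ler_pM => //.
  - have [As _] := channel_psd t; by rewrite qform_sandwich// dotp_ge0.
  - by rewrite invr_ge0 ltW// gain_den_gt0.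
  - rewrite lef_pV2 ?posrE ?gain_den_gt0// lerD2l ler_wpM2r//.
      exact/psd_trace_ge0/possemidefmx_conj/channel_psd.
    by rewrite !e2 /harmonic lef_pV2 ?posrE// ler_nat ltnS.
rewrite (eq_integral (fun t => limn (g ^~ t))); last first.
  by move=> t _; apply/esym/cvg_lim => //; exact: glim.
have mg k : measurable_fun setT (g k).
  by apply/measurable_EFinP; exact: measurable_gain.
have g0 k t : setT t -> 0 <= g k t by rewrite lee_fin gain_ge0.
have cv := @cvg_monotone_convergence _ _ _ m _ measurableT g mg g0 (fun t _ => gnd t).
rewrite -(cvg_lim _ cv)//; apply: lime_le.
  by apply/cvg_ex; eexists; exact: cv.
by near=> k; exact: integral_gain.
Unshelve. all: by end_near. Qed.

End vector_channel.

(** * The information of the channel *)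

Section resolvent.
Context {R : realType} {n : nat}.
Implicit Types (A B M : 'M[R]_n).

Lemma posdefmx_addI B : possemidefmx B -> posdefmx (1%:M + B).
Proof.
move=> [Bs Bp]; split; first by rewrite linearD /= trmx1 Bs.
move=> v v0; rewrite -/(qform _ v) qformD ltr_pwDl ?Bp//.
have -> : qform 1%:M v = \sum_i v i 0 ^+ 2.
  by rewrite -[1%:M]mulmx1 -{1}trmx1 qform_gram mul1mx.
have [i vi] : exists i, v i 0 != 0.
  by apply: contrapT => /forallNP h; case/eqP: v0; apply/colP => i;
    rewrite mxE; apply/eqP; rewrite -[_ == _]negbK; apply/negP/h.
rewrite (bigD1 i)//= ltr_pwDl ?exprn_even_gt0//.
by apply: sumr_ge0 => j _; exact: sqr_ge0.
Qed.

Lemma posdefmx_gram M : M \in unitmx -> posdefmx (M^T *m M).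
Proof.
move=> Mu; split; first by rewrite trmx_mul trmxK.
move=> v v0; rewrite -/(qform _ v) qform_gram.
have Mv0 : M *m v != 0.
  by apply: contra_neq v0 => Mv; rewrite -[v](mulKmx Mu) Mv mulmx0.
have [i vi] : exists i, (M *m v) i 0 != 0.
  by apply: contrapT => /forallNP h; case/eqP: Mv0; apply/colP => i;
    rewrite [RHS]mxE; apply/eqP; rewrite -[_ == _]negbK; apply/negP/h.
rewrite (bigD1 i)//= ltr_pwDl ?exprn_even_gt0//.
by apply: sumr_ge0 => j _; exact: sqr_ge0.
Qed.

Lemma trace_gram_ge0 M : 0 <= \tr (M *m M^T).
Proof.
apply: sumr_ge0 => i _; rewrite mxE; apply: sumr_ge0 => j _.
by rewrite mxE -expr2 sqr_ge0.
Qed.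

(** Expanding [N (1 + B) (1 + B) N^T = 1] gives [N N^T + 2 N B N^T + N B^2 N^T = 1], and the traces
    of the last two terms are nonnegative. This is the form in which 1 + t B is compared with (1 +
    B)^2. *)
Lemma resolvent_trace_le B (t : R) : possemidefmx B -> t <= 2 ->
  let N := invmx (1%:M + B) in
  t * \tr (N *m B *m N^T) + \tr (N *m N^T) <= n%:R.
Proof.
move=> pB t2; cbv zeta; set N := invmx _.
have [Bs Bp] := pB.
have Pu : 1%:M + B \in unitmx by exact/posdefmx_unit/posdefmx_addI.
have Ns : N^T = N by rewrite /N trmx_inv linearD /= trmx1 Bs.
have E : (1%:M : 'M[R]_n) = N *m N^T + N *m B *m N^T + N *m B *m N^T + (N *m B) *m (N *m B)^T.
  have <- : N *m (1%:M + B) *m ((1%:M + B) *m N^T) = 1%:M.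
    by rewrite Ns mulVmx// mulmxV// mulmx1.
  have -> : N *m (1%:M + B) = N + N *m B by rewrite mulmxDr mulmx1.
  have -> : (1%:M + B) *m N^T = N^T + B *m N^T by rewrite mulmxDl mul1mx.
  by rewrite trmx_mul Bs mulmxDl !mulmxDr !mulmxA !addrA.
have h1 := psd_trace_ge0 (possemidefmx_conj N pB).
have h2 := trace_gram_ge0 (N *m B).
have h3 : n%:R = \tr (N *m N^T) + \tr (N *m B *m N^T) + \tr (N *m B *m N^T) +
    \tr ((N *m B) *m (N *m B)^T).
  by rewrite -(mxtrace1 R) E !mxtraceD.
rewrite h3; nra.
Qed.

End resolvent.

Section channel_information.
Context {R : realType} {n : nat}.
Local Notation I := (measurableTypeR R * n.-tuple R)%type.
Variables (mu : probability (n.-tuple R) R) (M : 'M[R]_n).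
Hypotheses (cov_mu : cov_exists mu).

Let Y := whiten mu M.
Let mY := measurable_whiten mu M.
Let iY := whiten_integrable M cov_mu.
Let iYY := whiten_norm_integrable M cov_mu.

Variables (m : probability I R) (mu_ : R.-pker I ~> (n.-tuple R)).
Hypothesis dm : is_density (@refprob R n) m (obsmarg mu Y).
Hypothesis dmu : forall t, is_density mu (mu_ t) (fun x => postden mu Y (t, x)).

Let mden := measurable_postden mY iY iYY.
Let den0 := postden_ge0 mY iY iYY.
Let den_gt0 := postden_gt0 mY iY iYY.
Let denB := postden_bounded mY iY iYY.
Let mint := integral_m_postden mY iY iYY dm.
Let marg_gt0 := obsmarg_gt0 mY iY iYY.
Let S := covmx mu.
Let S' := M *m S *m M^T.
Let N := invmx (1%:M + S').

(** The relative entropy of the posterior with respect to [mu]; its mean over [m] is the mutual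
    information, equal to the loss of entropy. *)
Definition information (t : I) : R := \int[mu_ t]_x ln (postden mu Y (t, x)).

Let ln_postdenE t x : ln (postden mu Y (t, x)) =
  Num.sqrt t.1 * dotp t.2 (Y x) - Num.sqrt t.1 ^+ 2 / 2 * dotp (Y x) (Y x) -
  ln (obsmarg mu Y t).
Proof. by rewrite ln_div ?posrE ?obslik_gt0 ?marg_gt0// expRK. Qed.

Lemma ln_postden_integrable t : (mu_ t).-integrable setT
  (fun x => (ln (postden mu Y (t, x)))%:E).
Proof.
under eq_fun do rewrite ln_postdenE.
apply: rintegrableB.
  exact: (mixture_integrable mden den0 dmu denB (lnlik_integrable iY iYY t)).
exact: (rintegrable_cst_mass1 (channel_mass1 mu_ t)).
Qed.

Lemma measurable_ln_postden : measurable_fun setT (fun z => ln (postden mu Y z)).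
Proof. exact: (measurableT_comp (@measurable_ln R) mden). Qed.

Let mlnw t : measurable_fun setT (fun x => ln (postden mu Y (t, x))).
Proof. exact: (measurableT_comp measurable_ln_postden (pair1_measurable t)). Qed.

Let minvw t : measurable_fun setT (fun x => expR (- ln (postden mu Y (t, x)))).
Proof.
by apply: (measurableT_comp (@measurable_expR R)); exact: measurable_funN.
Qed.

Let invden_integral t : (\int[mu_ t]_x (expR (- ln (postden mu Y (t, x))))%:E = 1)%E.
Proof.
rewrite (ge0_integral_density (dmu t)); last 2 first.
- exact/measurable_EFinP.
- by move=> x; rewrite lee_fin expR_ge0.
rewrite (eq_integral (cst 1%E)) => [|x _]; last first.
  by rewrite expRN lnK ?posrE// -EFinM mulVf// gt_eqF.
by rewrite integral_cst// mul1e; exact: (@probability_setT _ _ _ mu).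
Qed.

Let invden_integrable t :
  (mu_ t).-integrable setT (fun x => (expR (- ln (postden mu Y (t, x))))%:E).
Proof.
apply: ge0_rintegrable; [exact: minvw|by move=> x; exact: expR_ge0|].
by rewrite invden_integral ltry.
Qed.

(* The integrand [w ln w] of the relative entropy is replaced by the nonnegative
   [w ln w - w + 1], so that Tonelli's theorem applies. *)
Lemma information_integral t : (information t)%:E = (\int[mu_ t]_x
  (ln (postden mu Y (t, x)) - 1 + expR (- ln (postden mu Y (t, x))))%:E)%E.
Proof.
have c1 := channel_mass1 mu_ t.
have i1 := ln_postden_integrable t; have i0 := rintegrable_cst_mass1 c1 1.
have i2 := invden_integrable t; have i3 := rintegrableB i1 i0.
rewrite -EFin_Rintegral; last exact: rintegrableD.
congr EFin; rewrite RintegralD// RintegralB// (Rintegral_cst_mass1 c1) -/(information t).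
by rewrite [X in _ + X](_ : _ = 1) ?subrK// /Rintegral invden_integral.
Qed.

Lemma information_ge0 t : 0 <= information t.
Proof.
rewrite -lee_fin information_integral; apply: integral_ge0 => x _; rewrite lee_fin.
by have := expR_ge1Dx (- ln (postden mu Y (t, x))); lra.
Qed.

Lemma measurable_information : measurable_fun setT information.
Proof.
apply/measurable_EFinP.
under [X in measurable_fun _ X]eq_fun do rewrite /= information_integral.
pose F (z : I * n.-tuple R) := (ln (postden mu Y z) - 1 + expR (- ln (postden mu Y z)))%:E.
have mF : measurable_fun setT F.
  have mln := measurable_ln_postden.
  apply/measurable_EFinP/measurable_funD; first exact: measurable_funB.
  by apply: (measurableT_comp (@measurable_expR R)); exact: measurable_funN.
apply: (measurable_integral_mixture mden den0 dmu mF) => z; rewrite lee_fin.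
by have := expR_ge1Dx (- ln (postden mu Y z)); lra.
Qed.

Let res t x := combt 1 t.2 (- Num.sqrt t.1) (Y x).

Let resE t x : dotp (res t x) (res t x) = dotp t.2 t.2 -
  2 * (Num.sqrt t.1 * dotp t.2 (Y x) - Num.sqrt t.1 ^+ 2 / 2 * dotp (Y x) (Y x)).
Proof. by rewrite /res !dotp_combl !dotp_combr (dotpC (Y x)); field. Qed.

Let Q1 t := \int[mu_ t]_x dotp (res t x) (res t x).

Let res_integrable t : (mu_ t).-integrable setT (fun x => (dotp (res t x) (res t x))%:E).
Proof.
under eq_fun do rewrite resE.
apply: rintegrableB; first exact: (rintegrable_cst_mass1 (channel_mass1 mu_ t)).
apply: rintegrableZl.
exact: (mixture_integrable mden den0 dmu denB (lnlik_integrable iY iYY t)).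
Qed.

(** The log-likelihood is half of [|g|^2] minus half of the squared residual. As [res] recovers the
    noise from the observation and [x], [Q1] is the posterior mean of [|z|^2]. *)
Let information_res t : information t + Q1 t / 2 =
  dotp t.2 t.2 / 2 - ln (obsmarg mu Y t).
Proof.
have c1 := channel_mass1 mu_ t.
rewrite mulrC /Q1 -RintegralZl// -RintegralD//; last 2 first.
- exact: ln_postden_integrable.
- exact: rintegrableZl.
rewrite -[RHS](Rintegral_cst_mass1 c1); apply: eq_Rintegral => x _.
by rewrite ln_postdenE resE; field.
Qed.

(* [q] is the density with respect to N(0, Id) of N(0, (1 + S')^2), whose covariance
   dominates the covariance [1 + t S'] of the observation, as [t <= 2]. *)
Let qN (g : n.-tuple R) := qform (N^T *m N) (colvec g).
Let q (g : n.-tuple R) := \det N * expR ((dotp g g - qN g) / 2).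

Let Spsd : possemidefmx S'.
Proof.
apply: possemidefmx_conj; apply: covmx_psd => //.
exact: (@probability_setT _ _ _ mu).
Qed.

Let Nu : N \in unitmx.
Proof. by rewrite unitmx_inv; exact/posdefmx_unit/posdefmx_addI. Qed.

Let detN_gt0 : 0 < \det N.
Proof. by rewrite det_inv invr_gt0; exact/posdefmx_det_gt0/posdefmx_addI. Qed.

Let q_gt0 g : 0 < q g. Proof. by rewrite mulr_gt0// expR_gt0. Qed.

(** Gibbs' inequality before integration: [ln u <= u - 1] at [u = q / obsmarg]. The terms
    [dotp t.2 t.2] cancel against those in [ln q]. *)
Let information_le t : information t + Q1 t / 2 + 1 <=
  qN t.2 / 2 - ln (\det N) + q t.2 / obsmarg mu Y t.
Proof.
rewrite information_res.
have h : ln (q t.2 / obsmarg mu Y t) <= q t.2 / obsmarg mu Y t - 1.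
  have c1 : - 1 < q t.2 / obsmarg mu Y t - 1.
    by rewrite ltrBrDr addrC subrr divr_gt0.
  by have := le_ln1Dx c1; rewrite addrC subrK.
move: h; rewrite ln_div ?posrE// lnM ?posrE ?expR_gt0// expRK; lra.
Qed.

Let gauss1T : (@gauss R n) setT = 1%E.
Proof. exact: (@probability_setT _ _ _ (@gauss R n)). Qed.

Let mu1T : mu setT = 1%E.
Proof. exact: (@probability_setT _ _ _ mu). Qed.

Lemma integral_gauss_norm : (\int[@gauss R n]_z (dotp z z)%:E = n%:R%:E)%E.
Proof.
under eq_integral do rewrite dotp_basis -sumEFin.
rewrite ge0_integral_sum//; last 2 first.
- by move=> i; apply/measurable_EFinP/measurable_funX; vfun.
- by move=> i z _; rewrite lee_fin sqr_ge0.
transitivity (\sum_(i < n) 1%:E : \bar R)%E; last by rewrite sumEFin sumr_const card_ord.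
apply: eq_bigr => i _.
transitivity (\int[@gauss R n]_z ((0 + dotp (tvec (delta_mx i 0)) z) ^+ 2)%:E)%E.
  by apply: eq_integral => z _; rewrite add0r.
rewrite integral_gauss_sqr expr0n add0r dotpE tvecK trmx_delta.
by rewrite -rowE !mxE !eqxx.
Qed.

(** Disintegrated the other way, the residual is exactly [z], whatever the time and [x]. *)
Let Q1_integral : (\int[m]_t (Q1 t)%:E = n%:R%:E)%E.
Proof.
pose F (z : I * n.-tuple R) := (dotp (res z.1 z.2) (res z.1 z.2))%:E.
have mres : measurable_fun setT (fun z : I * n.-tuple R => res z.1 z.2).
  apply/measurable_fun_tnthP => i.
  rewrite [X in measurable_fun _ X](_ : _ = fun z : I * n.-tuple R =>
      1 * tnth z.1.2 i + - Num.sqrt z.1.1 * tnth (Y z.2) i); last first.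
    by apply/funext => z /=; rewrite tnth_mktuple.
  apply: measurable_funD; apply: measurable_funM => //.
  - apply: (measurableT_comp (measurable_tnth i)).
    exact: (measurableT_comp measurable_snd measurable_fst).
  - apply: measurable_funN; apply: (measurableT_comp measurable_sqrt).
    exact: (measurableT_comp measurable_fst measurable_fst).
  - apply: (measurableT_comp (measurable_tnth i)).
    exact: (measurableT_comp mY measurable_snd).
have mF : measurable_fun setT F.
  by apply/measurable_EFinP; exact: measurable_dotp.
have F0 z : (0 <= F z)%E by rewrite lee_fin dotp_ge0.
rewrite (eq_integral (fun t => \int[mu_ t]_x F (t, x)))%E => [|t _]; last first.
  by rewrite -EFin_Rintegral; [|exact: res_integrable].
rewrite (integral_joint mY iY iYY dm dmu mF F0).
have E s x : (\int[@gauss R n]_z F ((s, combt 1 z (Num.sqrt s) (Y x)), x) = n%:R%:E)%E.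
  rewrite -integral_gauss_norm; apply: eq_integral => z _.
  rewrite /F /res /=; congr (_ %:E).
  have -> : combt 1 (combt 1 z (Num.sqrt s) (Y x)) (- Num.sqrt s) (Y x) = z.
    by apply: eq_from_tnth => i; rewrite !tnth_mktuple; ring.
  by [].
under eq_integral do under eq_integral do rewrite E.
under eq_integral do rewrite integral_cst// [X in (_ * X)%E]mu1T mule1.
by rewrite integral_cst// [X in (_ * X)%E](@probability_setT _ _ _ timelaw) mule1.
Qed.

Let row_N i := tvec (row i N)^T.

Let qNE g : qN g = \sum_i dotp (row_N i) g ^+ 2.
Proof.
rewrite /qN qform_gram; apply: eq_bigr => i _; congr (_ ^+ 2).
by rewrite dotpE tvecK trmxK -row_mul [RHS]mxE.
Qed.

Let qN_ge0 g : 0 <= qN g.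
Proof. by rewrite qNE; apply: sumr_ge0 => i _; exact: sqr_ge0. Qed.

Let mqN : measurable_fun setT qN.
Proof. by rewrite /qN; apply: measurable_qform. Qed.

Let sum_qform : \sum_i qform S (M^T *m colvec (row_N i)) = \tr (N *m S' *m N^T).
Proof.
apply: eq_bigr => i _; rewrite tvecK -qform_conj -/S' /qform trmxK.
rewrite -row_mul !mxE; apply: eq_bigr => k _; rewrite !mxE; congr *%R.
Qed.

Let sum_dotp : \sum_i dotp (row_N i) (row_N i) = \tr (N *m N^T).
Proof.
apply: eq_bigr => i _; rewrite dotpE tvecK trmxK !mxE.
by apply: eq_bigr => k _; rewrite !mxE.
Qed.

(** At time [s] the mean of [|N g|^2] is the trace of [N (1 + s S') N^T]; apply
    [resolvent_trace_le]. *)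
Let qN_integral : (\int[m]_t (qN t.2)%:E <= n%:R%:E)%E.
Proof.
pose F (z : I * n.-tuple R) := (qN z.1.2)%:E.
have mF : measurable_fun setT F.
  apply/measurable_EFinP; apply: (measurableT_comp mqN).
  exact: (measurableT_comp measurable_snd measurable_fst).
have F0 z : (0 <= F z)%E by rewrite lee_fin qN_ge0.
rewrite (eq_integral (fun t => \int[mu_ t]_x F (t, x)))%E => [|t _]; last first.
  by rewrite /F /= integral_cst// [X in (_ * X)%E](channel_mass1 mu_ t) mule1.
rewrite (integral_joint mY iY iYY dm dmu mF F0).
have E s x : (\int[@gauss R n]_z F ((s, combt 1 z (Num.sqrt s) (Y x)), x) =
    (Num.sqrt s ^+ 2 * \sum_i dotp (row_N i) (Y x) ^+ 2 + \tr (N *m N^T))%:E)%E.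
  transitivity (\int[@gauss R n]_z \sum_i
      ((Num.sqrt s * dotp (row_N i) (Y x) + dotp (row_N i) z) ^+ 2)%:E)%E.
    apply: eq_integral => z _; rewrite /F /= qNE -sumEFin; apply: eq_bigr => i _.
    by rewrite dotp_combr mul1r addrC.
  rewrite ge0_integral_sum//; last 2 first.
  - by move=> i; apply/measurable_EFinP/measurable_funX; vfun.
  - by move=> i z _; rewrite lee_fin sqr_ge0.
  under eq_bigr do rewrite integral_gauss_sqr exprMn.
  by rewrite sumEFin big_split /= sum_dotp -mulr_sumr.
apply: timelaw_le_cst.
- exact: (measurable_joint_time mu mY mF F0).
- by move=> s; do 2 (apply: integral_ge0 => ? _).
move=> s /andP[s1 s2].
under eq_integral do rewrite E.
have i1 i : mu.-integrable setT (fun x => (dotp (row_N i) (Y x) ^+ 2)%:E).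
  exact: whiten_sqr_integrable.
have i2 : mu.-integrable setT (fun x => (\sum_i dotp (row_N i) (Y x) ^+ 2)%:E).
  exact: rintegrable_sum.
have i3 := rintegrableZl (Num.sqrt s ^+ 2) i2.
have i4 := rintegrable_cst_mass1 mu1T (\tr (N *m N^T)).
rewrite -EFin_Rintegral; last exact: rintegrableD.
rewrite (RintegralD measurableT i3 i4) (RintegralZl _ measurableT i2).
rewrite (Rintegral_cst_mass1 mu1T) Rintegral_sum//.
under eq_bigr do rewrite Rintegral_whiten_sqr//.
rewrite sum_qform sqr_sqrtr ?(le_trans ler01)// lee_fin.
exact: resolvent_trace_le.
Qed.

Let mq : measurable_fun setT q.
Proof.
apply: measurable_funM => //; apply: (measurableT_comp (@measurable_expR R)).
by apply: measurable_funM => //; apply: measurable_funB => //; vfun.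
Qed.

Let measurable_ratio : measurable_fun setT (fun t : I => q t.2 / obsmarg mu Y t).
Proof.
apply: measurable_funM; first exact: (measurableT_comp mq measurable_snd).
have -> : (fun t => (obsmarg mu Y t)^-1) = (fun t => expR (- ln (obsmarg mu Y t))).
  by apply/funext => t; rewrite expRN lnK// posrE marg_gt0.
apply: (measurableT_comp (@measurable_expR R)); apply: measurable_funN.
exact: (measurableT_comp (@measurable_ln R) (measurable_obsmarg mu mY)).
Qed.

Let ratio_integral : (\int[m]_t (q t.2 / obsmarg mu Y t)%:E = 1)%E.
Proof.
rewrite (integral_m mY iY iYY dm); last 2 first.
- exact/measurable_EFinP.
- by move=> t; rewrite lee_fin ltW// divr_gt0.
have E : (\int[@gauss R n]_g (q g)%:E = 1)%E.
  rewrite /q; under eq_integral do rewrite EFinM.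
  rewrite ge0_integralZl; [|by []| |by move=> g _; rewrite lee_fin expR_ge0|
    by rewrite lee_fin ltW]; last first.
    by apply/measurable_EFinP; apply: (measurableT_comp (@measurable_expR R));
      apply: measurable_funM => //; apply: measurable_funB => //; vfun.
  rewrite integral_gauss_qform; last exact: posdefmx_gram.
  rewrite det_mulmx det_tr -expr2 sqrtr_sqr gtr0_norm// -EFinM divff//.
  by rewrite gt_eqF.
under eq_integral do under eq_integral do rewrite -EFinM divfK ?gt_eqF//.
under eq_integral do rewrite E.
by rewrite integral_cst// mul1e (@probability_setT _ _ _ timelaw).
Qed.

Let m1T : m setT = 1%E.
Proof. exact: (@probability_setT _ _ _ m). Qed.

Let Q1_ge0 t : 0 <= Q1 t.
Proof. by apply: Rintegral_ge0 => x _; exact: dotp_ge0. Qed.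

Let Q1_integrable : m.-integrable setT (fun t => (Q1 t)%:E).
Proof.
apply: ge0_rintegrable => //; last by rewrite Q1_integral ltry.
have -> : Q1 = fun t => dotp t.2 t.2 - 2 * ln (obsmarg mu Y t) - 2 * information t.
  by apply/funext => t; have := information_res t; lra.
have mlnp : measurable_fun setT (fun t => ln (obsmarg mu Y t)).
  exact: (measurableT_comp (@measurable_ln R) (measurable_obsmarg mu mY)).
apply: measurable_funB; last by apply: measurable_funM => //; exact: measurable_information.
apply: measurable_funB; last exact: measurable_funM.
by apply: measurable_dotp; exact: measurable_snd.
Qed.

Let qN_integrable : m.-integrable setT (fun t : I => (qN t.2)%:E).
Proof.
apply: ge0_rintegrable => //; first exact: (measurableT_comp mqN measurable_snd).
by rewrite (le_lt_trans qN_integral)// ltry.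
Qed.

Let ratio_integrable : m.-integrable setT (fun t : I => (q t.2 / obsmarg mu Y t)%:E).
Proof.
apply: ge0_rintegrable.
- exact: measurable_ratio.
- by move=> t; rewrite ltW// divr_gt0.
- by rewrite ratio_integral ltry.
Qed.

Let bound_integrable : m.-integrable setT (fun t : I =>
  (2^-1 * qN t.2 - ln (\det N) + q t.2 / obsmarg mu Y t)%:E).
Proof.
apply: rintegrableD => //; apply: rintegrableB; first exact: rintegrableZl.
exact: (rintegrable_cst_mass1 m1T).
Qed.

(** Dropping [Q1 >= 0] from [information_le] places the information between 0 and an integrable
    function. *)
Lemma information_integrable : m.-integrable setT (fun t => (information t)%:E).
Proof.
apply: (le_rintegrable measurable_information _ bound_integrable) => t.
rewrite ger0_norm ?information_ge0//.
have := information_le t; have := Q1_ge0 t; lra.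
Qed.

(** In the mean, [Q1 / 2] gives n / 2, [qN / 2] at most n / 2, and the ratio gives 1; only
    [- ln (\det N)] is left after cancellation. *)
Lemma integral_information : \int[m]_t information t <= ln (\det (1%:M + S')).
Proof.
have i1 := information_integrable.
have i0 k := rintegrable_cst_mass1 m1T k.
have i2 := rintegrableZl 2^-1 Q1_integrable.
have i3 := rintegrableZl 2^-1 qN_integrable.
have Q1R : \int[m]_t Q1 t = n%:R.
  by rewrite /Rintegral Q1_integral.
have ratioR : \int[m]_t (q t.2 / obsmarg mu Y t) = 1.
  by rewrite /Rintegral ratio_integral.
have qNR : \int[m]_t qN t.2 <= n%:R.
  by rewrite -lee_fin EFin_Rintegral.
have : \int[m]_t (information t + 2^-1 * Q1 t + 1) <=
    \int[m]_t (2^-1 * qN t.2 - ln (\det N) + q t.2 / obsmarg mu Y t).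
  apply: le_Rintegral => //.
  - by apply: rintegrableD => //; exact: rintegrableD.
  - by move=> t _; have := information_le t; lra.
rewrite (RintegralD measurableT (rintegrableD i1 i2) (i0 1)) (RintegralD measurableT i1 i2).
rewrite (RintegralZl _ measurableT Q1_integrable) Q1R.
rewrite (RintegralD measurableT (rintegrableB i3 (i0 _)) ratio_integrable) ratioR.
rewrite (RintegralB measurableT i3 (i0 _)) (RintegralZl _ measurableT qN_integrable).
rewrite !(Rintegral_cst_mass1 m1T).
have -> : ln (\det N) = - ln (\det (1%:M + S')).
  by rewrite det_inv lnV// posrE; exact/posdefmx_det_gt0/posdefmx_addI.
lra.
Qed.

End channel_information.

(** Conjugation by [M] carries the nonsymmetric matrix on the left to the positive definite one of
    the information bound. *)
Lemma det_conj_addI {R : realType} n (M S : 'M[R]_n) : M \in unitmx ->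
  \det (S *m (M^T *m M) + 1%:M) = \det (1%:M + M *m S *m M^T).
Proof.
move=> Mu.
have E : M *m (S *m (M^T *m M) + 1%:M) = (1%:M + M *m S *m M^T) *m M.
  by rewrite mulmxDr mulmxDl mulmx1 mul1mx addrC !mulmxA.
have /(congr1 determinant) := E; rewrite !det_mulmx mulrC => /mulIf.
by apply; rewrite -unitfE -unitmxE.
Qed.

Theorem theorem2 (R : realType) (n : nat)
    (nu : {measure set (n.-tuple R) -> \bar R})
    (mu : probability (n.-tuple R) R)
    (cov_mu : cov_exists mu) (entropy_mu : entropy_exists nu mu) :
  forall L : 'M[R]_n, posdefmx L ->
  exists (d : measure_display) (I : measurableType d)
         (m : probability I R) (mu_ : R.-pker I ~> (n.-tuple R)),
    (forall A : set (n.-tuple R), measurable A ->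
       mu A = (\int[m]_t mu_ t A)%E) /\
    (forall t, entropy_exists nu (mu_ t)) /\
    (forall t, cov_exists (mu_ t)) /\
    (m.-integrable setT (fun t => (entropy nu (mu_ t))%:E) /\
     entropy nu mu - \int[m]_t entropy nu (mu_ t)
       <= ln (\det (covmx mu *m L + 1%:M)) /\
     ln (\det (covmx mu *m L + 1%:M)) <= \tr (covmx mu *m L)) /\
    (mxintegrable m (fun t => covmx (mu_ t)) /\
     loewner_le (mxintegral m (fun t => covmx (mu_ t))) (invmx L)) /\
    (mxintegrable m (fun t => covmx (mu_ t) *m L *m covmx (mu_ t)) /\
     loewner_le (mxintegral m (fun t => covmx (mu_ t) *m L *m covmx (mu_ t)))
                (covmx mu)).
Proof.
move=> L pL; have [M LE] := posdefmx_cholesky pL.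
have Mu : M \in unitmx.
  by have := posdefmx_unit pL; rewrite LE unitmx_mul => /andP[].
have mu1 : mu setT = 1%E by exact: (@probability_setT _ _ _ mu).
have psd_cov := covmx_psd mu1 cov_mu.
have mY := measurable_whiten mu M.
have iY := whiten_integrable M cov_mu.
have iYY := whiten_norm_integrable M cov_mu.
have [m [mu_ [dm dmu]]] := ex_channel mY iY iYY.
have mden := measurable_postden mY iY iYY.
have den0 := postden_ge0 mY iY iYY.
have denB := postden_bounded mY iY iYY.
have mint := integral_m_postden mY iY iYY dm.
have [[f df] lnrho] := entropy_mu.
have drho := density_is_density df.
have muT t : (mu_ t setT < +oo)%E by rewrite prob_kernel ltry.
have ilnrho t := mixture_integrable mden den0 dmu denB lnrho t.
have ilnw := ln_postden_integrable cov_mu dmu.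
have den_gt0 t x : 0 < postden mu (whiten mu M) (t, x) by exact: postden_gt0.
have entE t : entropy nu (mu_ t) = - information mu M mu_ t -
    (\int[mu_ t]_x ln (density nu mu x)).
  exact: (tilted_entropy (muT t) drho (dmu t) (den_gt0 t) (ilnrho t) (ilnw t)).
have i1 := information_integrable cov_mu dm dmu.
have i2 := mixture_Rintegral_integrable mden den0 dmu mint denB lnrho.
exists _, (measurableTypeR R * n.-tuple R)%type, m, mu_.
split; first exact: (mixture_measure mden den0 dmu mint).
split.
  by move=> t; exact: (tilted_entropy_exists (muT t) drho (dmu t) (den_gt0 t) (ilnrho t) (ilnw t)).
split; first exact: (channel_cov_exists cov_mu dmu).
split; last split.
- have i3 : m.-integrable setT (fun t => (-1 * information mu M mu_ t)%:E).
    exact: rintegrableZl.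
  have entE' t : entropy nu (mu_ t) = -1 * information mu M mu_ t -
      (\int[mu_ t]_x ln (density nu mu x)) by rewrite mulN1r entE.
  rewrite LE (det_conj_addI _ Mu); split; last split.
  + by under eq_fun do rewrite entE'; exact: rintegrableB.
  + under eq_Rintegral do rewrite entE'.
    rewrite (RintegralB measurableT i3 i2) (RintegralZl _ measurableT i1).
    (* The posterior means of [ln (density nu mu x)] average back to minus [entropy nu mu]; after
       this cancellation the loss of entropy is the mean information. *)
    rewrite (mixture_Rintegral mden den0 dmu mint denB lnrho) /entropy mulN1r.
    have := integral_information cov_mu dm dmu; lra.
  + have := ln_det_le_trace (posdefmx_addI (possemidefmx_conj M psd_cov)).
    rewrite mxtraceD mxtrace1 addrAC subrr add0r.
    by rewrite [in X in _ -> X]mulmxA [\tr (_ *m M)]mxtrace_mulC mulmxA.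
- apply: loewner_mxintegral.
  + exact: (mxmeasurable_channel_cov cov_mu dm dmu).
  + exact: (channel_psd cov_mu dmu).
  + by rewrite trmx_inv; case: pL => ->.
  + by move=> v; rewrite LE; exact: (integral_channel_cov cov_mu Mu dm dmu).
- rewrite LE; apply: loewner_mxintegral.
  + exact: (mxmeasurable_sandwich cov_mu dm dmu).
  + move=> t; have [cs _] := channel_psd cov_mu dmu t.
    split=> [|v]; first by rewrite !trmx_mul trmxK cs !mulmxA.
    by rewrite -/(qform _ v) qform_sandwich// dotp_ge0.
  + by case: psd_cov.
  + by move=> v; exact: (integral_sandwich cov_mu dm dmu).
Qed.
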